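(* Let $f:\mathbb{R}^n\to\mathbb{R}$ be locally Lipschitz on $\mathbb{R}^n$ and continuously differentiable on an open set $D\subseteq\mathbb{R}^n$ whose complement has Lebesgue measure zero. Suppose Algorithm GS (described in the context) is run with $\nu_0>0$, $\nu_{\mathrm{opt}}=\epsilon_{\mathrm{opt}}=0$, and reduction factors $\theta_\nu<1$ and $\theta_\epsilon<1$. Then, with probability one, the algorithm is well defined in the sense that the gradients $\nabla f(x^k),\nabla f(x^{k,1}),\dots,\nabla f(x^{k,m})$ used in the direction computation exist at every iteration, the algorithm does not terminate, and either (i) $f(x^k)\searrow-\infty$, or (ii) $\nu_k\searrow 0$, $\epsilon_k\searrow 0$, and every cluster point of $\{x^k\}$ is Clarke stationary for $f$.
   Context: Notation: $\|\cdot\|_2$ is the Euclidean norm, $\mathbb{B}(x,\epsilon):=\{y\in\mathbb{R}^n:\|y-x\|_2\le\epsilon\}$, and $\mathrm{conv}$ denotes convex hull. Clarke subdifferential (for locally Lipschitz $f$): $\bar\partial f(x)=\mathrm{conv}\{\lim_{j\to\infty}\nabla f(y^j): y^j\to x,\ f \text{ differentiable at } y^j \text{ for all } j\}$. A point $x$ is Clarke stationary for $f$ if $0\in\bar\partial f(x)$. Algorithm GS. Inputs: an initial point $x^0$ at which $f$ is differentiable; initial sampling radius $\epsilon_0\in(0,\infty)$; initial stationarity target $\nu_0\in[0,\infty)$; sample size $m\ge n+1$; line search parameters $(\beta,\gamma)\in(0,1)\times(0,1)$; termination tolerances $(\epsilon_{\mathrm{opt}},\nu_{\mathrm{opt}})\in[0,\infty)\times[0,\infty)$;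 reduction factors $(\theta_\epsilon,\theta_\nu)\in(0,1]\times(0,1]$. For $k=0,1,2,\dots$: 1. Independently sample $x^{k,1},\dots,x^{k,m}$ uniformly from $\mathbb{B}(x^k,\epsilon_k)$. 2. Compute $g^k$ as the minimizer of $\tfrac12\|g\|_2^2$ over $g\in\mathrm{conv}\{\nabla f(x^k),\nabla f(x^{k,1}),\dots,\nabla f(x^{k,m})\}$. 3. If $\|g^k\|_2\le\nu_{\mathrm{opt}}$ and $\epsilon_k\le\epsilon_{\mathrm{opt}}$, terminate. 4. If $\|g^k\|_2\le\nu_k$, set $\nu_{k+1}=\theta_\nu\nu_k$, $\epsilon_{k+1}=\theta_\epsilon\epsilon_k$, $t_k=0$; otherwise set $\nu_{k+1}=\nu_k$, $\epsilon_{k+1}=\epsilon_k$, and $t_k=\max\{t\in\{1,\gamma,\gamma^2,\dots\}: f(x^k-tg^k)<f(x^k)-\beta t\|g^k\|_2^2\}$. 5. If $f$ is differentiable at $x^k-t_kg^k$, set $x^{k+1}=x^k-t_kg^k$; otherwise set $x^{k+1}$ randomly as any point at which $f$ is differentiable such that $f(x^{k+1})<f(x^k)-\beta t_k\|g^k\|_2^2$ and $\|x^k-t_kg^k-x^{k+1}\|_2\le\min\{t_k,\epsilon_k\}\|g^k\|_2$. *)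

(* Defs.v *)
From HB Require Import structures.
From mathcomp Require Import all_boot all_order all_algebra.
From mathcomp Require Import all_classical all_reals all_analysis.
Set Implicit Arguments.
Unset Strict Implicit.
Unset Printing Implicit Defensive.
Import Order.TTheory GRing.Theory Num.Theory.
Import numFieldNormedType.Exports.
Local Open Scope classical_set_scope.
Local Open Scope ring_scope.

Section GSdefs.
Context {R : realType} {n : nat}.
Local Notation vec := 'rV[R]_n.

Definition edot (u v : vec) : R := \sum_(i < n) u ord0 i * v ord0 i.
Definition enorm (v : vec) : R := Num.sqrt (edot v v).

Definition eball (x : vec) (e : R) : set vec := [set y | enorm (y - x) <= e].

Definition grad (f : vec -> R) (x : vec) : vec :=
  \row_(i < n) ('d f x (delta_mx ord0 i : vec)).

Definition conv (S : set vec) : set vec :=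
  [set v | exists (k : nat) (p : 'I_k -> vec) (l : 'I_k -> R),
      (forall i, S (p i)) /\ (forall i, 0 <= l i) /\
      \sum_(i < k) l i = 1 /\ v = \sum_(i < k) l i *: p i].

Definition limiting_gradients (f : vec -> R) (x : vec) : set vec :=
  [set v | exists y : nat -> vec,
      y @ \oo --> x /\ (forall j, differentiable f (y j)) /\
      (fun j => grad f (y j)) @ \oo --> v].
Definition clarke_subdiff (f : vec -> R) (x : vec) : set vec :=
  conv (limiting_gradients f x).
Definition clarke_stationary (f : vec -> R) (x : vec) : Prop :=
  clarke_subdiff f x 0.

Definition locally_lipschitz (f : vec -> R) : Prop :=
  forall x, exists delta L : R, 0 < delta /\
    forall y z, eball x delta y -> eball x delta z ->
      `|f y - f z| <= L * enorm (y - z).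

Definition C1_on (f : vec -> R) (D : set vec) : Prop :=
  (forall x, D x -> differentiable f x) /\
  (forall x, D x -> grad f @ x --> grad f x).

Definition obox (a b : vec) : set vec :=
  [set y | forall i, a ord0 i < y ord0 i < b ord0 i].
Definition bvol (a b : vec) : R :=
  \prod_(i < n) Num.max (b ord0 i - a ord0 i) 0.
Definition leb_outer (A : set vec) : \bar R :=
  ereal_inf [set z | exists a b : nat -> vec,
      A `<=` \bigcup_k obox (a k) (b k) /\
      z = (\sum_(0 <= k <oo) (bvol (a k) (b k))%:E)%E].
Definition leb_null (A : set vec) : Prop := leb_outer A = 0%E.

Definition min_norm_elt (G : set vec) (g : vec) : Prop :=
  conv G g /\ forall h, conv G h -> enorm g ^+ 2 / 2 <= enorm h ^+ 2 / 2.

End GSdefs.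

(* Random objects generated by the run of GS up to the start of iteration k:
   the iterates x^0..x^k, the radii/targets eps_0..eps_k, nu_0..nu_k, and
   the samples, directions and steps of iterations 0..k-1. *)
Definition history_gen {R : realType} {n m : nat} {d : measure_display}
  {Omega : measurableType d}
  (x : nat -> Omega -> 'rV[R]_n) (U : nat -> 'I_m -> Omega -> 'rV[R]_n)
  (g : nat -> Omega -> 'rV[R]_n) (eps nu t : nat -> Omega -> R) (k : nat)
  : set (set Omega) :=
  [set A | exists j : nat,
     ((j <= k)%N /\ exists a b, A = x j @^-1` obox a b) \/
     ((j <= k)%N /\ exists a b : R, A = eps j @^-1` `]a, b[) \/
     ((j <= k)%N /\ exists a b : R, A = nu j @^-1` `]a, b[) \/
     ((j < k)%N /\ exists i a b, A = U j i @^-1` obox a b) \/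
     ((j < k)%N /\ exists a b, A = g j @^-1` obox a b) \/
     ((j < k)%N /\ exists a b : R, A = t j @^-1` `]a, b[)].

Section GSalgo.
Context {R : realType} {n m : nat} {Omega : Type}.
Local Notation vec := 'rV[R]_n.

(* the set {grad f(x^k), grad f(x^{k,1}), ..., grad f(x^{k,m})}, where the
   sample points are x^{k,i} = x^k + eps_k * U^{k,i} *)
Definition sample_grads (f : vec -> R) (xk : vec) (ek : R) (Uk : 'I_m -> vec)
  : set vec :=
  [set v | v = grad f xk \/ exists i, v = grad f (xk + ek *: Uk i)].

Definition gs_well_defined (f : vec -> R) (x : nat -> Omega -> vec)
  (U : nat -> 'I_m -> Omega -> vec) (eps : nat -> Omega -> R) (k : nat)
  (w : Omega) : Prop :=
  differentiable f (x k w) /\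
  forall i, differentiable f (x k w + eps k w *: U k i w).

(* the termination test of Step 3 with nu_opt = eps_opt = 0 *)
Definition gs_terminates (gk : vec) (ek : R) : Prop := enorm gk <= 0 /\ ek <= 0.

(* the set of admissible step sizes {t in {1, gamma, gamma^2, ...} : f(x - t g) <
   f(x) - beta t ||g||^2}; t_k is its maximum *)
Definition armijo_steps (f : vec -> R) (beta gamma : R) (xk gk : vec) : set R :=
  [set s | (exists j : nat, s = gamma ^+ j) /\
           f (xk - s *: gk) < f xk - beta * s * enorm gk ^+ 2].
End GSalgo.

(* Main.v *)
Require Import Defs.
From HB Require Import structures.
From mathcomp Require Import all_boot all_order all_algebra.
From mathcomp Require Import all_classical all_reals all_analysis.
From mathcomp Require Import measurable_realfun ring lra.

(* The mollification [F z = E (f (z + e U))] of [f] along a uniform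
   vector [U] only sees gradients at points of [D], so a bound on [<grad f, h>]
   over [D] near a segment bounds the increment of [f] along it: this replaces
   Lebourg's mean value theorem and avoids Rademacher's theorem.  Hence, when the
   gradients at the samples have an almost minimal-norm convex combination (by
   Caratheodory [n + 1] samples suffice), either [g^k] is small or the line
   search accepts a step bounded away from 0.  If the radius were reduced only
   finitely often, the decrease of [f] would make [x^k] converge and [t_k] vanish;
   but by independence the samples fall infinitely often into any prescribed boxes
   of positive probability, a contradiction.  So the reductions go on forever,
   and near each cluster point there are iterates with small [g^k] and
   small sampling radius; upper semicontinuity of the Clarke subdifferential
   concludes.  Well-definedness holds because a vector with bounded density,
   independent of the past, almost surely misses the null set [~` D]. *)

Set Implicit Arguments.
Unset Strict Implicit.
Unset Printing Implicit Defensive.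
Import Order.TTheory GRing.Theory Num.Theory.
Import numFieldNormedType.Exports.
Local Open Scope classical_set_scope.
Local Open Scope ring_scope.

(** * Euclidean geometry of row vectors *)

Section Euclid.
Context {R : realType} {n : nat}.
Implicit Types u v w : 'rV[R]_n.

(** The limit of the iterates in the contradiction depends on the whole path, and so does the sample
    configuration that would force a long step; no single event of positive probability can be fixed
    in advance. The samples are therefore shown to hit, almost surely and after every index, each
    tuple of grid boxes that meets the open unit ball. There are countably many of these, and the
    target is selected among them path by path. Once countably many negligible events are discarded,
    the analysis of a run concerns one path only.

    The random radius is treated in the same spirit: [eps k] can only be some
    [theta_eps ^+ j * eps0], so null sets are avoided for each deterministic radius separately.
    Independence is given on boxes and [leb_outer] is defined by covers with boxes; accordingly no
    product measure on vectors is built, and a grid discretisation of the centre takes the place of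
    Fubini's theorem. *)

Lemma edotC u v : edot u v = edot v u.
Proof. by apply: eq_bigr => i _; rewrite mulrC. Qed.

Lemma edotDl u v w : edot (u + v) w = edot u w + edot v w.
Proof. by rewrite /edot -big_split; apply: eq_bigr => i _; rewrite mxE mulrDl. Qed.

Lemma edotZl a u v : edot (a *: u) v = a * edot u v.
Proof. by rewrite /edot mulr_sumr; apply: eq_bigr => i _; rewrite mxE mulrA. Qed.

Lemma edotDr u v w : edot w (u + v) = edot w u + edot w v.
Proof. by rewrite edotC edotDl !(edotC _ w). Qed.

Lemma edotZr a u v : edot u (a *: v) = a * edot u v.
Proof. by rewrite edotC edotZl edotC. Qed.

Lemma edotNl u v : edot (- u) v = - edot u v.
Proof. by rewrite -scaleN1r edotZl mulN1r. Qed.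

Lemma edotNr u v : edot u (- v) = - edot u v.
Proof. by rewrite edotC edotNl edotC. Qed.

Lemma edot0l v : edot 0 v = 0.
Proof. by rewrite -(scale0r 0) edotZl mul0r. Qed.

Lemma edot_suml (I : finType) (p : I -> 'rV[R]_n) v :
  edot (\sum_i p i) v = \sum_i edot (p i) v.
Proof.
rewrite /edot exchange_big /=; apply: eq_bigr => j _.
by rewrite summxE mulr_suml.
Qed.

Lemma edot_ge0 v : 0 <= edot v v.
Proof. by apply: sumr_ge0 => i _; rewrite -expr2 sqr_ge0. Qed.

Lemma enorm_ge0 v : 0 <= enorm v.
Proof. exact: sqrtr_ge0. Qed.

Lemma enorm_sqr v : enorm v ^+ 2 = edot v v.
Proof. by rewrite sqr_sqrtr // edot_ge0. Qed.

Lemma enormZ a v : enorm (a *: v) = `|a| * enorm v.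
Proof.
by rewrite /enorm edotZl edotZr mulrA -expr2 sqrtrM ?sqr_ge0 // sqrtr_sqr.
Qed.

Lemma enormN v : enorm (- v) = enorm v.
Proof. by rewrite -scaleN1r enormZ normrN1 mul1r. Qed.

Lemma enorm0 : enorm (0 : 'rV[R]_n) = 0.
Proof. by rewrite /enorm edot0l sqrtr0. Qed.

Lemma enormB u v : enorm (u - v) = enorm (v - u).
Proof. by rewrite -enormN opprB. Qed.

Lemma cauchy_schwarz u v : edot u v <= enorm u * enorm v.
Proof.
have [/eqP u0|u0] := boolP (edot u u == 0).
  suff -> : u = 0 by rewrite edot0l mulr_ge0 ?enorm_ge0.
  apply/rowP => i; rewrite mxE; move/eqP: u0.
  rewrite psumr_eq0 => [/allP/(_ i (mem_index_enum _))|j _].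
    by rewrite -expr2 sqrf_eq0 => /eqP.
  by rewrite -expr2 sqr_ge0.
have u_gt0 : 0 < edot u u by rewrite lt_def u0 edot_ge0.
apply: (@le_trans _ _ `|edot u v|); first exact: ler_norm.
rewrite -(@ler_pXn2r _ 2) ?nnegrE ?mulr_ge0 ?enorm_ge0 //.
rewrite exprMn !enorm_sqr real_normK ?num_real //.
have := edot_ge0 (edot u u *: v - edot u v *: u).
rewrite !(edotDl, edotDr, edotNl, edotNr, edotZl, edotZr) (edotC v u).
move=> H; rewrite -(ler_pM2l u_gt0); nra.
Qed.

Lemma enormD u v : enorm (u + v) <= enorm u + enorm v.
Proof.
rewrite -(@ler_pXn2r _ 2) ?nnegrE ?addr_ge0 ?enorm_ge0 //.
rewrite sqrrD !enorm_sqr edotDl !edotDr (edotC v u) -(enorm_sqr u).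
have := cauchy_schwarz u v; lra.
Qed.

Lemma enorm_sum (I : finType) (p : I -> 'rV[R]_n) :
  enorm (\sum_i p i) <= \sum_i enorm (p i).
Proof.
elim/big_rec2: _ => [|i a v _ h]; first by rewrite enorm0.
by apply: (le_trans (enormD _ _)); rewrite lerD2l.
Qed.

Lemma enorm_lexi u (c : R) : 0 <= c -> edot u u <= c ^+ 2 -> enorm u <= c.
Proof. by move=> c0 h; rewrite -[leRHS](ger0_norm c0) -sqrtr_sqr ler_sqrt // sqr_ge0. Qed.

Lemma enorm_coord v i : `|v ord0 i| <= enorm v.
Proof.
rewrite -sqrtr_sqr ler_sqrt ?edot_ge0 // /edot (bigD1 i) //= -expr2 lerDl.
by apply: sumr_ge0 => j _; rewrite -expr2 sqr_ge0.
Qed.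


Lemma norm_coord v i : `|v ord0 i| <= `|v|.
Proof.
by rewrite [leRHS]/Num.Def.normr /= mx_normrE; apply: (le_bigmax _ _ (ord0, i)).
Qed.

Lemma norm_le_enorm v : `|v| <= enorm v.
Proof.
rewrite [leLHS]/Num.Def.normr /= mx_normrE; apply: bigmax_le; first exact: enorm_ge0.
by move=> [i j] _ /=; rewrite (ord1 i) enorm_coord.
Qed.

(** The crude constant [n.+1], in place of the square root of [n], is never zero and can be divided
    by in every dimension. *)
Lemma enorm_le_sup v (c : R) : 0 <= c -> (forall i, `|v ord0 i| <= c) ->
  enorm v <= n.+1%:R * c.
Proof.
move=> c0 h; apply: enorm_lexi; first by rewrite mulr_ge0.
apply: (@le_trans _ _ (\sum_(i < n) c ^+ 2)).
  apply: ler_sum => i _; rewrite -expr2 -real_normK ?num_real //.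
  by rewrite ler_pXn2r ?nnegrE.
rewrite sumr_const card_ord -[leLHS]mulr_natl exprMn ler_wpM2r ?sqr_ge0 //.
by rewrite -natrX ler_nat (leq_trans (leqnSn n)) // -{1}(expn1 n.+1) leq_pexp2l.
Qed.

Lemma enorm_le_norm v : enorm v <= n.+1%:R * `|v|.
Proof. by apply: enorm_le_sup => // i; exact: norm_coord. Qed.

(** The topology on row vectors comes from the sup norm; this makes it accessible through the
    Euclidean norm of the algorithm. *)
Lemma nbhs_enorm (x : 'rV[R]_n) (A : set 'rV[R]_n) :
  nbhs x A <-> exists2 e : R, 0 < e & forall y, enorm (y - x) < e -> A y.
Proof.
split.
  move=> /nbhs_ballP [e /= e0 h]; exists e => // y yx; apply: h.
  rewrite -ball_normE /= distrC.
  by apply: le_lt_trans yx; exact: norm_le_enorm.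
move=> [e e0 h]; apply/nbhs_ballP; exists (e / n.+1%:R); first exact: divr_gt0.
move=> y; rewrite -ball_normE /= distrC ltr_pdivlMr // mulrC => yx; apply: h.
by apply: le_lt_trans yx; exact: enorm_le_norm.
Qed.

Lemma cvg_enorm (T : Type) (F : set_system T) (FF : Filter F) (u : T -> 'rV[R]_n)
    (l : 'rV[R]_n) :
  u @ F --> l <-> forall e : R, 0 < e -> \forall w \near F, enorm (u w - l) < e.
Proof.
split=> [ul e|h A /nbhs_enorm[e e0 hA]].
  by move=> e0; have /ul : nbhs l [set y | enorm (y - l) < e] by apply/nbhs_enorm; exists e.
by have := h _ e0; apply: filterS => w; exact: hA.
Qed.
End Euclid.

(** * Increments and gradients of locally Lipschitz functions *)

Section Calculus.
Context {R : realType} {n : nat}.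
Implicit Types u v w x h : 'rV[R]_n.
Implicit Types f : 'rV[R]_n -> R.

Lemma diff_edot f x h : 'd f x h = edot (grad f x) h :> R.
Proof.
rewrite {1}(row_sum_delta h) linear_sum /=.
by apply: eq_bigr => i _; rewrite linearZ /= mxE mulrC.
Qed.

Lemma directional_derivative f x h (e : R) : differentiable f x -> 0 < e ->
  exists2 d : R, 0 < d & forall t, `|t| < d ->
    `|f (x + t *: h) - f x - t * edot (grad f x) h| <= e * `|t|.
Proof.
move=> df e0; have := @diff_derivable _ _ _ f x h df; rewrite /derivable => dfh.
have {dfh} : (fun t => t^-1 *: ((f \o shift x) (t *: h) - f x)) @ 0^' --> ('D_h f x : R).
  exact: dfh.
rewrite deriveE // diff_edot => /cvgrPdist_lt /(_ e e0).
move=> /nbhs_ballP[d /= d0 hd]; exists d => // t td.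
have [->|t0] := eqVneq t 0; first by rewrite scale0r addr0 subrr mul0r subr0 normr0 mulr0.
have := hd t; rewrite /ball /= sub0r normrN => /(_ td t0) /ltW.
rewrite /= (addrC _ x) distrC => ht.
rewrite -ler_pdivrMr ?normr_gt0 //; apply: le_trans ht.
rewrite -normfV -normrM mulrBl [t * _ * _]mulrAC divff // mul1r mulrC.
exact: lexx.
Qed.


(* Real induction: the set of [s] with [phi s - phi 0 <= c * s] contains its
   supremum, which therefore is 1. *)
Lemma increment_le (phi : R -> R) (c : R) :
  (forall s e, 0 < s <= 1 -> 0 < e -> exists2 d, 0 < d &
     forall r, 0 <= r -> s - d < r < s -> phi s - phi r <= e) ->
  (forall s d, 0 <= s < 1 -> 0 < d ->
    exists2 t, 0 < t < d & phi (s + t) - phi s <= c * t) ->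
  phi 1 - phi 0 <= c.
Proof.
move=> cphi step.
pose A := [set s : R | 0 <= s <= 1 /\ phi s - phi 0 <= c * s].
have A0 : A 0 by split; [rewrite lexx ler01|rewrite subrr mulr0].
have ubA : has_ubound A by exists 1 => s [/andP[_ ->]].
have supA : has_sup A by split => //; exists 0.
set s := sup A.
have s01 : 0 <= s <= 1.
  apply/andP; split; first exact: ub_le_sup.
  by apply: ge_sup; [exists 0|move=> r [/andP[_ ->]]].
have As : A s.
  split => //; rewrite leNgt; apply/negP => bad.
  have s_neq0 : s != 0 by apply: contraTneq bad => ->; rewrite subrr mulr0 ltxx.
  have s_gt0 : 0 < s by rewrite lt_def s_neq0; case/andP: s01.
  (* Half of the excess goes to the left continuity of [phi] at [s]; the other half pays for
     [c * (r - s)], whence the second bound on the gap [s - r]. *)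
  pose e := (phi s - phi 0 - c * s) / 2.
  have e0 : 0 < e by rewrite divr_gt0 // subr_gt0.
  have c1 : 0 < `|c| + 1 by rewrite ltr_wpDl.
  have [|d d0 hd] := cphi s e _ e0; first by rewrite s_gt0; case/andP: s01.
  have d'0 : 0 < Num.min d (e / (`|c| + 1)) by rewrite lt_min d0 divr_gt0.
  have [r Ar] := sup_adherent d'0 supA; rewrite -/s => sr.
  have rs : r <= s by exact: ub_le_sup.
  have [rs'|/eqP rs'] := boolP (r == s).
    by case: Ar; rewrite (eqP rs') => _; rewrite leNgt bad.
  have {rs rs'} rs : r < s by rewrite lt_def rs andbT eq_sym; apply/eqP.
  have sr1 : s - d < r.
    by apply: le_lt_trans sr; rewrite lerD2l lerN2 ge_min lexx.
  have sr2 : s - r < e / (`|c| + 1).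
    rewrite ltrBlDr -ltrBlDl; apply: le_lt_trans sr.
    by rewrite lerD2l lerN2 ge_min lexx orbT.
  case: Ar => /andP[r0 _] hr; have := hd r r0; rewrite sr1 rs => /(_ isT) hsr.
  move: sr2; rewrite ltr_pdivlMr // => sr2.
  have : c * (r - s) <= `|c| * (s - r).
    by rewrite -opprB mulrN -mulNr ler_wpM2r ?subr_ge0 ?(ltW rs) // -normrN ler_norm.
  move: sr2 hr hsr; rewrite /e => sr2 hr hsr habs; lra.
have [s1|/eqP s1] := boolP (s == 1).
  by case: As => _; rewrite (eqP s1) mulr1.
have slt1 : s < 1 by rewrite lt_def eq_sym; case/andP: s01 => _ ->; rewrite andbT; apply/eqP.
have [||t /andP[t0 td] ht] := step s (1 - s); first by rewrite slt1; case/andP: s01 => ->.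
  by rewrite subr_gt0.
suff : A (s + t) by move/(ub_le_sup ubA); rewrite -/s; lra.
split; last by case: As => _; lra.
by move: s01 td => /andP[]; lra.
Qed.

Lemma eball_compact x (r : R) : compact (eball x r).
Proof.
apply: bounded_closed_compact.
  exists (enorm x + r); split; first exact: num_real.
  move=> M hM y hy; apply: (le_trans (norm_le_enorm _)); apply: le_trans (ltW hM).
  by rewrite -[y](subrK x) addrC (le_trans (enormD _ _)) // lerD2l.
rewrite -[X in closed X]setCK; apply: open_closedC; rewrite openE => y /= /negP.
rewrite -ltNge => ry; apply/nbhs_enorm; exists (enorm (y - x) - r).
  by rewrite subr_gt0.
move=> z zy /=; apply/negP; rewrite -ltNge.
have := enormD (y - z) (z - x); rewrite addrA subrK (enormB y z) => h.
lra.
Qed.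

(** Compactness makes the constant [L] uniform. The radius [d] may stay local, because
    [lipschitz_on_eball] only glues local bounds along a segment. *)
Lemma locally_lipschitz_uniform f x (r : R) : locally_lipschitz f ->
  exists2 L : R, 0 <= L & forall y, eball x r y -> exists2 d, 0 < d &
    forall z z', enorm (z - y) < d -> enorm (z' - y) < d ->
      `|f z - f z'| <= L * enorm (z - z').
Proof.
move=> lf.
pose P (L : R) y := 0 <= L /\ exists2 d, 0 < d & forall z z',
  enorm (z - y) < d -> enorm (z' - y) < d -> `|f z - f z'| <= L * enorm (z - z').
have := (compact_near_coveringP (eball x r)).1 (eball_compact (x := x) (r := r)).
move=> /(_ R (pinfty_nbhs R) P _)[].
  move=> y _; have [d [L [d0 hd]]] := lf y.
  exists (([set z | enorm (z - y) < d / 2], [set M | Num.max L 0 < M])).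
    split; first by apply/nbhs_enorm; exists (d / 2); [rewrite divr_gt0|].
    by exists (Num.max L 0); rewrite num_real.
  move=> [z M] /= [zy]; rewrite gt_max => /andP[LM M0]; split; first exact: ltW.
  exists (d / 2); first by rewrite divr_gt0.
  move=> a b az bz; apply: (@le_trans _ _ (L * enorm (a - b))).
    apply: hd; rewrite /eball /= -[_ - y](subrKA z) (le_trans (enormD _ _)) //; lra.
  by rewrite ler_wpM2r ?enorm_ge0 // ltW.
move=> M [_ hM]; exists (`|M| + 1); first by rewrite addr_ge0.
move=> y yx; have [|_] := hM (`|M| + 1) _ y yx; last exact.
by apply: (@le_lt_trans _ _ `|M|); rewrite ?ler_norm ?ltrDl.
Qed.

Lemma eball_convex x (r : R) y z (s : R) : eball x r y -> eball x r z ->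
  0 <= s <= 1 -> eball x r (y + s *: (z - y)).
Proof.
rewrite /eball /= => hy hz /andP[s0 s1].
have -> : y + s *: (z - y) - x = (1 - s) *: (y - x) + s *: (z - x).
  by apply/rowP => i; rewrite !mxE; ring.
apply: (le_trans (enormD _ _)); rewrite !enormZ !ger0_norm ?subr_ge0 //.
have : (1 - s) * enorm (y - x) <= (1 - s) * r by rewrite ler_wpM2l ?subr_ge0.
have : s * enorm (z - x) <= s * r by rewrite ler_wpM2l.
lra.
Qed.

(** The ball is convex, so real induction along the segment from [y] to [z] glues the local bounds
    without loss in the constant. *)
Lemma lipschitz_on_eball f x (r : R) : locally_lipschitz f ->
  exists2 L : R, 0 <= L & forall y z, eball x r y -> eball x r z ->
    `|f y - f z| <= L * enorm (y - z).
Proof.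
move=> lf; have [L L0 hL] := locally_lipschitz_uniform x r lf.
exists L => // y z.
wlog suff main : / forall y z, eball x r y -> eball x r z ->
    f z - f y <= L * enorm (z - y).
  move=> hy hz; rewrite ler_norml; have := main _ _ hy hz; have := main _ _ hz hy.
  by rewrite (enormB z y); lra.
move=> {y z} y z hy hz.
pose phi (s : R) := f (y + s *: (z - y)).
have -> : f z - f y = phi 1 - phi 0 by rewrite /phi scale0r scale1r addr0 subrKC.
have loc s : 0 <= s <= 1 -> exists2 d, 0 < d & forall a b, `|a - s| < d ->
    `|b - s| < d -> phi b - phi a <= L * enorm (z - y) * `|b - a|.
  move=> hs; have [d d0 hd] := hL _ (eball_convex hy hz hs).
  have e0 : 0 < enorm (z - y) + 1 by rewrite ltr_wpDl ?enorm_ge0.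
  exists (d / (enorm (z - y) + 1)); first by rewrite divr_gt0.
  have near_s a : `|a - s| < d / (enorm (z - y) + 1) ->
      enorm (y + a *: (z - y) - (y + s *: (z - y))) < d.
    rewrite ltr_pdivlMr // => has.
    rewrite opprD addrACA subrr add0r -scalerBl enormZ.
    by apply: le_lt_trans has; rewrite ler_wpM2l // lerDl.
  move=> a b has hbs; rewrite /phi.
  have := hd _ _ (near_s _ hbs) (near_s _ has).
  rewrite opprD addrACA subrr add0r -scalerBl enormZ mulrA mulrAC.
  by apply: le_trans; exact: ler_norm.
have N0 : 0 <= L * enorm (z - y) by rewrite mulr_ge0 ?enorm_ge0.
apply: increment_le => [s e s01 e0|s d s01 d0].
  have [|d d0 hd] := loc s; first by case/andP: s01 => /ltW -> ->.
  pose c := L * enorm (z - y) + 1.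
  have c0 : 0 < c by rewrite ltr_wpDl.
  exists (Num.min d (e / c)); first by rewrite lt_min d0 divr_gt0.
  move=> r0 _ /andP[h1 h2].
  have h3 : s - r0 < d /\ s - r0 < e / c.
    have : s - r0 < Num.min d (e / c) by lra.
    by rewrite lt_min => /andP.
  apply: (le_trans (hd r0 s _ _)); rewrite ?subrr ?normr0 //.
    by rewrite ltr0_norm; lra.
  rewrite gtr0_norm ?subr_gt0 //; move: h3 => [_]; rewrite ltr_pdivlMr // /c.
  have : 0 < s - r0 by lra.
  lra.
have [|d' d'0 hd] := loc s; first by case/andP: s01 => -> /ltW ->.
pose t := Num.min d d' / 2.
have m0 : 0 < Num.min d d' by rewrite lt_min d0.
have t0 : 0 < t by rewrite divr_gt0.
have [td td'] : t < d /\ t < d'.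
  have : t < Num.min d d' by rewrite /t; lra.
  by rewrite lt_min => /andP.
exists t; first by rewrite t0.
apply: (le_trans (hd s (s + t) _ _)); rewrite ?subrr ?normr0 //.
  by rewrite addrAC subrr add0r gtr0_norm.
by rewrite addrAC subrr add0r gtr0_norm.
Qed.

(** Moving from [y] in the direction of the gradient [g] itself compares [enorm g ^+ 2] with
    [L * enorm g]. *)
Lemma grad_bound f x (r L : R) y : 0 <= L ->
  (forall y z, eball x r y -> eball x r z -> `|f y - f z| <= L * enorm (y - z)) ->
  differentiable f y -> enorm (y - x) < r -> enorm (grad f y) <= L.
Proof.
move=> L0 lf df yr; set g := grad f y.
suff main : forall e, 0 < e -> enorm g ^+ 2 <= L * enorm g + e.
  have : enorm g ^+ 2 <= L * enorm g by apply/ler_addgt0Pr => e; exact: main.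
  have [->//|g0] := eqVneq (enorm g) 0.
  by rewrite expr2 ler_pM2r // lt_def g0 enorm_ge0.
move=> e e0; have [d d0 hd] := directional_derivative g df e0.
have gp : 0 < enorm g + 1 by rewrite ltr_wpDl ?enorm_ge0.
have rp : 0 < r - enorm (y - x) by rewrite subr_gt0.
pose t := Num.min d ((r - enorm (y - x)) / (enorm g + 1)) / 2.
have m0 : 0 < Num.min d ((r - enorm (y - x)) / (enorm g + 1)).
  by rewrite lt_min d0 divr_gt0.
have t0 : 0 < t by rewrite divr_gt0.
have [td] : t < d /\ t < (r - enorm (y - x)) / (enorm g + 1).
  have : t < Num.min d ((r - enorm (y - x)) / (enorm g + 1)) by rewrite /t; lra.
  by rewrite lt_min => /andP.
rewrite ltr_pdivlMr // => tr.
have hy : eball x r y by exact: ltW.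
have hyt : eball x r (y + t *: g).
  rewrite /eball /= addrAC (le_trans (enormD _ _)) // enormZ gtr0_norm //; lra.
have := lf _ _ hyt hy; rewrite addrAC subrr add0r enormZ.
have := hd t; rewrite gtr0_norm // => /(_ td) h1 h2.
have : t * edot g g <= t * (L * enorm g + e).
  move: h1 h2; rewrite !ler_norml -/g => /andP[h1 _] /andP[_ h2].
  by move: h1 h2; lra.
by rewrite ler_pM2l // enorm_sqr.
Qed.
End Calculus.

(** * Volume of boxes *)

Section Boxes.
Context {R : realType} {n : nat}.
Implicit Types a b : 'rV[R]_n.
Local Open Scope ereal_scope.

Lemma leb_outer_mono (A B : set 'rV[R]_n) : A `<=` B -> leb_outer A <= leb_outer B.
Proof.
move=> AB; apply: ereal_inf_le_tmp => _ [a [b [Bab ->]]].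
by exists a, b; split => //; exact: subset_trans Bab.
Qed.

Lemma bvol_ge0 a b : (0 <= bvol a b)%R.
Proof. by apply: prodr_ge0 => i _; rewrite le_max lexx orbT. Qed.

(** The one-box cover is padded to a sequence by boxes of volume 0. These exist only for [0 < n],
    since in dimension 0 the empty product gives every box volume 1. *)
Lemma leb_outer_obox a b : (0 < n)%N -> leb_outer (obox a b) <= (bvol a b)%:E.
Proof.
move=> n0; apply: ereal_inf_lbound.
pose a' (k : nat) : 'rV[R]_n := if k == 0%N then a else 0%R.
pose b' (k : nat) : 'rV[R]_n := if k == 0%N then b else 0%R.
exists a', b'; split; first by move=> y yab; exists 0%N.
rewrite nneseries_recl ?eseries0 /= ?adde0 //; last first.
  by move=> k _; rewrite lee_fin bvol_ge0.
move=> [|k] // _ _; rewrite /a' /b' /bvol /=; congr EFin.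
rewrite (bigD1 (Ordinal n0)) //= mxE subrr [Num.max _ _]maxxx mul0r //.
Qed.

Lemma itv_indicE (a b : R) :
  (fun s : R => (a < s < b)%R%:R : R) = \1_(`]a, b[%classic).
Proof. by apply/funext => s; rewrite indicE mem_setE in_itv. Qed.

Lemma integral_slice (a b p c C : R) : (0 <= c)%R -> (0 <= C)%R ->
  \int[lebesgue_measure]_(s in `[p, (p + c)%R]%classic)
    (C * (a < s < b)%R%:R)%:E <= (C * Num.max (b - a) 0)%:E.
Proof.
move=> c0 C0.
have -> : (fun s : R => (C * (a < s < b)%R%:R)%:E) =
    (fun s => C%:E * (\1_(`]a, b[%classic) s)%:E).
  by apply/funext => s; rewrite -itv_indicE.
rewrite ge0_integralZl //=; last first.
- exact/measurable_EFinP/measurable_indic.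
rewrite EFinM lee_wpmul2l // integral_indic //.
apply: (@le_trans _ _ (lebesgue_measure `]a, b[%classic)).
  by apply: le_measure; rewrite ?inE //; apply: measurableI.
rewrite lebesgue_measure_itv /=; case: ifPn => [_|_].
  by rewrite -EFinB lee_fin le_max lexx.
by rewrite lee_fin le_max lexx orbT.
Qed.

(** Integrating out one coordinate at a time, with series and integral exchanged at each step,
    reduces the subadditivity of volume to one-dimensional Lebesgue measure. *)
Lemma cube_le_cover (p : 'rV[R]_n) (c : R) (a b : nat -> 'rV[R]_n) : (0 <= c)%R ->
  [set y : 'rV[R]_n | forall i, p ord0 i <= y ord0 i <= p ord0 i + c]%R `<=`
    \bigcup_k obox (a k) (b k) ->
  (c ^+ n)%:E <= \sum_(0 <= k <oo) (bvol (a k) (b k))%:E.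
Proof.
move=> c0 cov.
(* The coordinates [i < j] of the indicator of each box have already been
   integrated out; initially the indicators add up to at least 1. *)
pose w (j : nat) (y : 'rV[R]_n) (k : nat) (i : 'I_n) : R :=
  if (i < j)%N then (Num.max (b k ord0 i - a k ord0 i) 0)%R
  else (a k ord0 i < y ord0 i < b k ord0 i)%R%:R.
have w0 j y k i : (0 <= w j y k i)%R.
  by rewrite /w; case: ifP => _ //; rewrite le_max lexx orbT.
have main j (y : 'rV[R]_n) : (j <= n)%N -> (forall i, p ord0 i <= y ord0 i <= p ord0 i + c)%R ->
    (c ^+ j)%:E <= \sum_(0 <= k <oo) (\prod_(i < n) w j y k i)%:E.
  elim: j y => [|j IH] y jn yp.
    have [k _ yk] := cov _ yp; rewrite expr0.
    rewrite (@nneseriesD1 _ _ k) //; last by move=> i _; rewrite lee_fin prodr_ge0.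
    rewrite [X in X%:E + _](_ : _ = 1%R); last first.
      by rewrite big1 // => i _; rewrite /w ltn0 yk.
    rewrite leeDl // nneseries_ge0 // => i _ _; rewrite lee_fin prodr_ge0 //.
  pose jo := Ordinal jn.
  pose upd (s : R) : 'rV[R]_n := (\row_i if i == jo then s else y ord0 i)%R.
  pose rest (k : nat) : R := (\prod_(i < n | i != jo) w j.+1 y k i)%R.
  have rest0 k : (0 <= rest k)%R by apply: prodr_ge0.
  have wE s k : (\prod_(i < n) w j (upd s) k i =
      rest k * (a k ord0 jo < s < b k ord0 jo)%R%:R)%R.
    rewrite (bigD1 jo) //= mulrC; congr (_ * _)%R; last by rewrite /w ltnn mxE eqxx.
    apply: eq_bigr => i ij; rewrite /w mxE (negbTE ij) ltnS.
    by rewrite (leq_eqVlt i j) -[j]/(nat_of_ord jo) -[(_ == _ :> nat)]/(i == jo) (negbTE ij).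
  have sE k : (\prod_(i < n) w j.+1 y k i =
      rest k * Num.max (b k ord0 jo - a k ord0 jo) 0)%R.
    by rewrite (bigD1 jo) //= mulrC /w ltnSn.
  pose I := `[p ord0 jo, (p ord0 jo + c)%R]%classic.
  have muI : lebesgue_measure (I : set R) = c%:E.
    rewrite lebesgue_measure_itv /= lte_fin ltrDl.
    case: ltP => h; first by rewrite -EFinB addrAC subrr add0r.
    by congr EFin; apply/eqP; rewrite eq_le c0 h.
  apply: (@le_trans _ _ (\int[lebesgue_measure]_(s in I) (c ^+ j)%:E)).
    have := @integral_cst _ _ R lebesgue_measure I (measurable_itv _) (c ^+ j)%:E.
    by rewrite [X in _ * X]muI -EFinM -exprSr => ->; exact: lexx.
  have mf k : measurable_fun I (fun s : R =>
      (rest k * (a k ord0 jo < s < b k ord0 jo)%R%:R)%:E).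
    apply/measurable_EFinP; apply: measurable_funM => //.
    rewrite itv_indicE.
    exact: measurable_indic.
  apply: (@le_trans _ _ (\int[lebesgue_measure]_(s in I) \sum_(0 <= k <oo)
      (rest k * (a k ord0 jo < s < b k ord0 jo)%R%:R)%:E)).
    apply: ge0_le_integral => //; first exact: measurable_itv.
    - by move=> s _; rewrite lee_fin exprn_ge0.
    - apply: ge0_emeasurable_sum => [k s _ _|k _]; last exact: mf.
      by rewrite lee_fin mulr_ge0.
    - move=> s; rewrite /I /= in_itv /= => hs.
      have /(IH _ (ltnW jn)) : forall i, (p ord0 i <= upd s ord0 i <= p ord0 i + c)%R.
        by move=> i; rewrite mxE; case: eqP => [->|_].
      by under eq_eseriesr do rewrite wE.
  rewrite integral_nneseries //; last 2 first.
  - exact: measurable_itv.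
  - by move=> k s _; rewrite lee_fin mulr_ge0.
  apply: lee_nneseries => [k _ _|k _].
    by apply: integral_ge0 => s _; rewrite lee_fin mulr_ge0.
  by rewrite sE; exact: integral_slice.
have pp : (forall i, p ord0 i <= p ord0 i <= p ord0 i + c)%R.
  by move=> i; rewrite lexx lerDl.
have := main n p (leqnn n) pp; under eq_eseriesr => k _.
  rewrite (eq_bigr (fun i => Num.max (b k ord0 i - a k ord0 i) 0)%R); last first.
    by move=> i _; rewrite /w ltn_ord.
  over.
by [].
Qed.

Lemma leb_outer_cube (p : 'rV[R]_n) (c : R) (A : set 'rV[R]_n) : (0 <= c)%R ->
  [set y : 'rV[R]_n | forall i, p ord0 i <= y ord0 i <= p ord0 i + c]%R `<=` A ->
  (c ^+ n)%:E <= leb_outer A.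
Proof.
move=> c0 pA; apply: le_ereal_inf_tmp => _ [a [b [Aab ->]]].
apply: cube_le_cover => //.
exact: (subset_trans pA Aab).
Qed.

End Boxes.

(** * Null sets and independent perturbations *)

Section Smearing.
Context {R : realType} {n : nat}.
Local Open Scope ereal_scope.

(** Half-open boxes are the cells of a floor grid: they partition the space, which open boxes cannot
    do. [hbox_bigcap] recovers them from the open boxes that generate the history. *)
Definition hbox (a b : 'rV[R]_n) : set 'rV[R]_n :=
  [set y | forall i, (a ord0 i <= y ord0 i < b ord0 i)%R].

Lemma hbox_bigcap (a b : 'rV[R]_n) :
  hbox a b = \bigcap_(k : nat) obox (a - const_mx k.+1%:R^-1)%R b.
Proof.
apply/seteqP; split => [y hy k _ i|y hy i].
  have /andP[h1 h2] := hy i; rewrite !mxE h2 andbT (lt_le_trans _ h1) //.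
  by rewrite ltrBlDr ltrDl invr_gt0.
have /andP[_ ->] := hy 0%N I i; rewrite andbT leNgt; apply/negP => h.
have /andP[+ _] := hy (Num.truncn (a ord0 i - y ord0 i)^-1) I i.
rewrite !mxE ltNge; move/negP; apply.
have d0 : (0 < a ord0 i - y ord0 i)%R by rewrite subr_gt0.
have := truncnS_gt (a ord0 i - y ord0 i)^-1.
rewrite -invf_plt ?posrE ?ltr0n // => h1; rewrite lerBrDr -lerBrDl; exact: ltW.
Qed.

Lemma sigma_algebra_hbox (T : Type) (G : set (set T)) (X : T -> 'rV[R]_n)
    (a b : 'rV[R]_n) :
  (forall a b, <<s G >> (X @^-1` obox a b)) -> <<s G >> (X @^-1` hbox a b).
Proof.
move=> h; rewrite hbox_bigcap preimage_bigcap.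
rewrite -[X in <<s _ >> X]setCK setC_bigcap.
have [_ sC sU] := smallest_sigma_algebra setT G.
by rewrite -setTD; apply: (sC); apply: sU => k; rewrite -setTD; apply: (sC); exact: h.
Qed.

(** In dimension 0 every box has volume 1, so even the empty set has outer measure at least 1; the
    mere existence of a null set excludes this case. *)
Lemma leb_outer_nat_gt0 (A : set 'rV[R]_n) : leb_null A -> (0 < n)%N.
Proof.
rewrite /leb_null lt0n => + ; apply: contra_eqN => /eqP n0.
apply/eqP => A0; have : 1 <= leb_outer A.
  apply: le_ereal_inf_tmp => _ [a [b [_ ->]]].
  rewrite nneseries_recl // => [|k _]; last by rewrite lee_fin bvol_ge0.
  rewrite /bvol [X in X%:E + _](_ : _ = 1%R); last first.
    by apply: big1 => i; move: (ltn_ord i); rewrite {2}n0.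
  by rewrite leeDl // nneseries_ge0 // => k _ _; rewrite lee_fin bvol_ge0.
by rewrite A0 leNgt lte01.
Qed.

Definition grid_index (h : R) (y : 'rV[R]_n) : 'rV[int]_n :=
  (\row_i Num.floor (y ord0 i / h))%R.

Lemma grid_indexE (h : R) (q : 'rV[int]_n) : (0 < h)%R ->
  [set y | grid_index h y = q] =
  hbox (\row_i ((q ord0 i)%:~R * h))%R (\row_i ((q ord0 i + 1)%:~R * h))%R.
Proof.
move=> h0; apply/seteqP; split => y.
  move=> /= <- i; rewrite !mxE -ler_pdivlMr // -ltr_pdivrMr //.
  exact: floor_itv.
move=> hy; apply/rowP => i; rewrite mxE; apply: floor_def.
by have := hy i; rewrite !mxE -ler_pdivlMr // -ltr_pdivrMr.
Qed.

Context {d : measure_display} {Omega : measurableType d} (P : probability Omega R).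
Variables (G : set Omega) (X W : Omega -> 'rV[R]_n) (K e : R).
Hypotheses (Gm : measurable G) (K0 : (0 <= K)%R) (e0 : (0 < e)%R).
Hypothesis Wm : forall a b, measurable (W @^-1` obox a b).
Hypothesis Xm : forall a b, measurable (X @^-1` hbox a b).
Hypothesis ind : forall a b a' b',
  P (X @^-1` hbox a b `&` (G `&` W @^-1` obox a' b')) <=
    P (X @^-1` hbox a b) * (K * bvol a' b')%:E.

(* [X] is discretised on a grid of mesh at most the shortest side of the box, so
   that each enlarged box has at most [2 ^ n] times the original volume. *)
Lemma smeared_box (a b : 'rV[R]_n) : exists S : set Omega,
  [/\ measurable S, G `&` [set w | obox a b (X w + e *: W w)%R] `<=` S &
      P S <= (K * (2 / e) ^+ n * bvol a b)%:E].
Proof.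
have [ab|] := pselect (forall i, a ord0 i < b ord0 i)%R; last first.
  move=> nab; exists set0; split => //.
    move=> w [_ /= hw]; apply: nab => i.
    by have /andP[h1 h2] := hw i; exact: lt_trans h2.
  by rewrite measure0 lee_fin !mulr_ge0 ?exprn_ge0 ?divr_ge0 ?bvol_ge0 // ltW.
have [h h0 hh] : exists2 h : R, (0 < h)%R & forall i, (h <= b ord0 i - a ord0 i)%R.
  exists (\big[Num.min/1%R]_i (b ord0 i - a ord0 i)%R).
    elim/big_ind: _ => // [x y|i _]; last by rewrite subr_gt0.
    by rewrite lt_min => -> ->.
  by move=> i; apply: bigmin_le_cond.
pose lo (q : 'rV[int]_n) : 'rV[R]_n := (\row_i ((q ord0 i)%:~R * h))%R.
pose hi (q : 'rV[int]_n) : 'rV[R]_n := (\row_i ((q ord0 i + 1)%:~R * h))%R.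
(* If [X w] lies between [lo q] and [hi q], then [X w + e *: W w] can be in the given box only if
   [W w] is in this one. Its sides are [(b - a + h) / e], at most [2 / e] times the given ones
   because [h] is at most the shortest side. *)
pose a' q : 'rV[R]_n := (e^-1 *: (a - hi q))%R.
pose b' q : 'rV[R]_n := (e^-1 *: (b - lo q))%R.
pose C (k : nat) := [set w | pickle (grid_index h (X w)) = k].
have CE k : C k = set0 \/ exists q, pickle q = k /\ C k = X @^-1` hbox (lo q) (hi q).
  have [[q qk]|nq] := pselect (exists q : 'rV[int]_n, pickle q = k).
    right; exists q; split => //; rewrite -grid_indexE //.
    by apply/seteqP; split => w; rewrite /C /=; rewrite -qk; [exact: (pcan_inj pickleK)|move=> ->].
  left; apply/seteqP; split => // w /= hw; apply: nq.
  by exists (grid_index h (X w)).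
have mC k : measurable (C k) by have [->|[q [_ ->]]] := CE k.
pose T k := C k `&` (G `&` if (unpickle k : option 'rV[int]_n) is Some q
   then W @^-1` obox (a' q) (b' q) else set0).
have mT k : measurable (T k).
  by do 2 apply: measurableI => //; case: unpickle.
have PT k : P (T k) <= P (C k) * (K * (2 / e) ^+ n * bvol a b)%:E.
  have [C0|[q [qk Cq]]] := CE k; first by rewrite /T C0 set0I measure0 mul0e.
  rewrite /T -{2}qk pickleK Cq; apply: (le_trans (ind _ _ _ _)).
  rewrite lee_wpmul2l // lee_fin -mulrA ler_wpM2l //.
  rewrite /bvol -[X in (_ ^+ X)%R]card_ord -prodr_const -big_split /=.
  apply: ler_prod => i _; rewrite le_max lexx orbT /= !mxE.
  have := hh i; have := ab i; move: (a ord0 i) (b ord0 i) => x y xy hxy.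
  rewrite [X in (_ <= _ * X)%R]max_l ?subr_ge0 ?(ltW xy) // ge_max.
  rewrite intrD -mulrBr mulrAC [(2 * _ / _)%R]mulrC.
  apply/andP; split; last by rewrite !mulr_ge0 ?invr_ge0 ?subr_ge0 // ltW.
  rewrite ler_pM2l ?invr_gt0 // ; lra.
exists (\bigcup_k T k); split; first exact: bigcupT_measurable.
  move=> w [Gw hw]; exists (pickle (grid_index h (X w))) => //.
  split => //; split => //; rewrite pickleK /= => i.
  have : hbox (lo (grid_index h (X w))) (hi (grid_index h (X w))) (X w).
    by rewrite -grid_indexE.
  move=> /(_ i); have := hw i; rewrite !mxE => /andP[h1 h2] /andP[h3 h4].
  by rewrite ltr_pdivrMl // ltr_pdivlMl //; apply/andP; split; lra.
apply: (le_trans (generalized_Boole_inequality _ mT (bigcupT_measurable _ mT))).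
apply: (le_trans (lee_nneseries _ (fun k _ => PT k))) => //.
(* The bound survives the sum over infinitely many cells because the [C k] are disjoint and their
   probabilities add up to at most 1. *)
under eq_eseriesr do rewrite muleC.
rewrite nneseriesZl // -[leRHS]mule1.
rewrite lee_wpmul2l ?lee_fin ?mulr_ge0 ?exprn_ge0 ?divr_ge0 ?bvol_ge0 ?(ltW e0) //.
rewrite -measure_semi_bigcup //; last by apply: bigcupT_measurable.
  by apply: probability_le1; apply: bigcupT_measurable.
by move=> i j _ _ [w [/= <- <-]].
Qed.

(** Covers of [N] by boxes of total volume below [l.+1%:R^-1] become, through [smeared_box],
    measurable covers of the event, and the intersection of these over [l] has probability 0. *)
Lemma smeared_null (N : set 'rV[R]_n) : leb_null N ->
  P.-negligible (G `&` [set w | N (X w + e *: W w)%R]).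
Proof.
move=> N0; pose M := (K * (2 / e) ^+ n)%R.
have M0 : (0 <= M)%R by rewrite mulr_ge0 ?exprn_ge0 ?divr_ge0 ?(ltW e0).
have cov (l : nat) : exists B : set Omega,
    [/\ measurable B, G `&` [set w | N (X w + e *: W w)%R] `<=` B &
        P B <= (M * l.+1%:R^-1)%:E].
  have l0 : (0 < l.+1%:R^-1 :> R)%R by rewrite invr_gt0.
  have [] := lb_ereal_inf_adherent l0 (_ : leb_outer N \is a fin_num).
    by rewrite N0.
  move=> _ [a [b [Nab ->]]]; rewrite -/(leb_outer N) N0 add0e => small.
  have [S hS] := choice (fun k => smeared_box (a k) (b k)).
  have mS k : measurable (S k) by have [] := hS k.
  exists (\bigcup_k S k); split; first exact: bigcupT_measurable.
    move=> w [Gw Nw]; have [k _ hk] := Nab _ Nw; exists k => //.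
    by have [_ h _] := hS k; apply: h.
  apply: (le_trans (generalized_Boole_inequality _ mS (bigcupT_measurable _ mS))).
  apply: (@le_trans _ _ (\sum_(0 <= k <oo) M%:E * (bvol (a k) (b k))%:E)).
    by apply: lee_nneseries => // k _; rewrite -EFinM; have [] := hS k.
  rewrite nneseriesZl => [|k _]; last by rewrite lee_fin bvol_ge0.
  by rewrite [leRHS]EFinM lee_wpmul2l // ltW.
have [B hB] := choice cov.
exists (\bigcap_l B l); split.
- by apply: bigcapT_measurable => l; have [] := hB l.
- apply/eqP; rewrite -measure_le0; apply/lee_addgt0Pr => r r0; rewrite add0e.
  pose l := Num.truncn (M / r).
  apply: (@le_trans _ _ (P (B l))).
    apply: le_measure; rewrite ?inE; last by move=> w /(_ l I).
      by apply: bigcapT_measurable => k; have [] := hB k.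
    by have [] := hB l.
  have [_ _ h] := hB l; apply: (le_trans h); rewrite lee_fin ler_pdivrMr //.
  by rewrite mulrC -ler_pdivrMr // ltW // truncnS_gt.
- by move=> w hw l _; have [_ h _] := hB l; apply: h.
Qed.

End Smearing.

(** * Uniform vectors in the unit ball *)

Section Grid.
Context {R : realType} {n : nat}.

(** A width of two grid steps makes neighbouring boxes overlap: a point on a grid line is still
    interior to one of them, so these countably many open boxes form a base of the topology. *)
Definition grid_box (l : nat) (z : 'rV[int]_n) : set 'rV[R]_n :=
  obox (\row_i ((z ord0 i)%:~R / l.+1%:R)) (\row_i ((z ord0 i + 2)%:~R / l.+1%:R)).

Lemma grid_box_fine (e : R) : 0 < e -> exists l, forall y : 'rV[R]_n,
  exists2 z, grid_box l z y & forall y', grid_box l z y' -> enorm (y' - y) < e.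
Proof.
move=> e0; pose l := Num.truncn (n.+1%:R * 2 / e); exists l => y.
have l0 : (0 : R) < l.+1%:R by [].
have le : n.+1%:R * (2 / l.+1%:R) < e.
  by rewrite mulrA ltr_pdivrMr // -ltr_pdivrMl // [e^-1 * _]mulrC truncnS_gt.
exists (\row_i (Num.floor (y ord0 i * l.+1%:R) - 1)).
  move=> i; rewrite !mxE ltr_pdivrMr // ltr_pdivlMr //.
  have := floor_itv (y ord0 i * l.+1%:R); rewrite !(intrD, mulrNz).
  move: (y ord0 i * _) => t => /andP[h1 h2].
  by apply/andP; split; lra.
move=> y' hy'; apply: le_lt_trans le; apply: enorm_le_sup.
  by rewrite divr_ge0.
move=> i; have := hy' i; rewrite !mxE ltr_pdivrMr // ltr_pdivlMr // => /andP[h1 h2].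
have /andP[h3 h4] := floor_itv (y ord0 i * l.+1%:R).
rewrite ler_pdivlMr // -[X in _ * X](gtr0_norm l0) -normrM mulrBl.
move: h1 h2 h3 h4; rewrite !(intrD, mulrNz).
move: (y' ord0 i * _) (y ord0 i * _) => s t h1 h2 h3 h4.
by rewrite ler_norml; apply/andP; split; lra.
Qed.

Lemma measurable_preimage_open (d : measure_display) (Omega : measurableType d)
    (W : Omega -> 'rV[R]_n) (O : set 'rV[R]_n) :
  (forall a b, measurable (W @^-1` obox a b)) -> open O -> measurable (W @^-1` O).
Proof.
move=> Wm oO.
pose B (k : nat) : set 'rV[R]_n := if (unpickle k : option (nat * 'rV[int]_n)) is Some (l, z)
  then (if `[< grid_box l z `<=` O >] then grid_box l z else set0) else set0.
have -> : O = \bigcup_k B k.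
  apply/seteqP; split => [y Oy|y [k _]]; last first.
    by rewrite /B; case: unpickle => [[l z]|//]; case: ifPn => // /asboolP; exact.
  have /nbhs_enorm[e e0 he] : nbhs y O by exact: open_nbhs_nbhs.
  have [l /(_ y)[z zy hz]] := grid_box_fine e0.
  exists (pickle (l, z)) => //; rewrite /B pickleK ifT //.
  by apply/asboolP => y' /hz; exact: he.
rewrite preimage_bigcup; apply: bigcupT_measurable => k; rewrite /B.
case: unpickle => [[l z]|]; last by rewrite preimage_set0.
by case: ifPn => _; [exact: Wm|rewrite preimage_set0].
Qed.
End Grid.

Section UniformBall.
Context {R : realType} {n : nat}.
Local Open Scope ereal_scope.

Lemma unit_ball_volume : (0 < n)%N ->
  exists2 v : R, (0 < v)%R & leb_outer (eball (0 : 'rV[R]_n) 1) = v%:E.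
Proof.
move=> n0; set V := leb_outer _.
have Vlo : ((n.+1%:R^-1 : R) ^+ n)%:E <= V.
  apply: (@leb_outer_cube _ _ 0); first by rewrite invr_ge0.
  move=> y hy; rewrite /eball /= subr0.
  apply: (le_trans (@enorm_le_sup _ _ _ n.+1%:R^-1 _ _)); rewrite ?invr_ge0 //.
    by move=> i; have := hy i; rewrite mxE add0r => /andP[h1 h2]; rewrite ger0_norm.
  by rewrite divff.
have Vhi : V <= (bvol (const_mx (-2) : 'rV[R]_n) (const_mx 2))%:E.
  apply: le_trans (leb_outer_obox _ _ n0); apply: leb_outer_mono => y.
  rewrite /eball /= subr0 => hy i; rewrite !mxE.
  by have := le_trans (enorm_coord y i) hy; rewrite ler_norml => /andP[h1 h2]; lra.
have Vfin : V \is a fin_num.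
  rewrite fin_numElt; apply/andP; split.
    by apply: lt_le_trans Vlo; rewrite ltNyr.
  by apply: (le_lt_trans Vhi); rewrite ltry.
exists (fine V); last by rewrite fineK.
rewrite -lte_fin fineK //; apply: lt_le_trans Vlo.
by rewrite lte_fin exprn_gt0 // invr_gt0.
Qed.

Context {d : measure_display} {Omega : measurableType d} (P : probability Omega R).
Variable W : Omega -> 'rV[R]_n.
Hypothesis n_gt0 : (0 < n)%N.
Hypothesis W_meas : forall a b, measurable (W @^-1` obox a b).
Hypothesis W_unif : forall a b,
  P (W @^-1` obox a b) * leb_outer (eball (0 : 'rV[R]_n) 1)
      = leb_outer (obox a b `&` eball 0 1).

(** The bound [K] on the density is the reciprocal of the volume of the unit ball. *)
Lemma unit_uniform_le : exists2 K : R, (0 <= K)%R &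
  forall a b, P (W @^-1` obox a b) <= (K * bvol a b)%:E.
Proof.
have [v v0 Vv] := unit_ball_volume n_gt0; exists (v^-1)%R; first by rewrite invr_ge0 ltW.
move=> a b; rewrite mulrC EFinM lee_pdivlMr // -Vv W_unif.
apply: (le_trans (leb_outer_mono (@subIsetl _ _ _))).
exact: leb_outer_obox.
Qed.

Lemma unit_uniform_gt0 a b u : obox a b u -> (enorm u < 1)%R -> 0 < P (W @^-1` obox a b).
Proof.
move=> uab u1; have [v v0 Vv] := unit_ball_volume n_gt0.
rewrite -(pmule_lgt0 _ (_ : 0 < v%:E)) // -Vv W_unif.
have [c c0 hc] : exists2 c : R, (0 < c)%R & forall i, (u ord0 i + c < b ord0 i)%R.
  exists ((\big[Num.min/1%R]_i (b ord0 i - u ord0 i)%R) / 2)%R.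
    rewrite divr_gt0 //; elim/big_ind: _ => // [x y|i _]; last first.
      by rewrite subr_gt0; case/andP: (uab i).
    by rewrite lt_min => -> ->.
  move=> i; have h : (0 < b ord0 i - u ord0 i)%R by rewrite subr_gt0; case/andP: (uab i).
  have : (\big[Num.min/1%R]_i (b ord0 i - u ord0 i)%R <= b ord0 i - u ord0 i)%R.
    exact: bigmin_le_cond.
  lra.
(* The cube with lower corner [u] and side [c'] fits into the box because of [c], and into the unit
   ball because its points are within [n.+1%:R * c'] of [u]. *)
pose c' := (Num.min c ((1 - enorm u) / n.+1%:R))%R.
have c'0 : (0 < c')%R by rewrite lt_min c0 divr_gt0 // subr_gt0.
apply: (@lt_le_trans _ _ (c' ^+ n)%:E); first by rewrite lte_fin exprn_gt0.
apply: (@leb_outer_cube _ _ u); first exact: ltW.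
move=> y hy; split.
  move=> i; have /andP[h1 h2] := hy i; have /andP[h3 h4] := uab i.
  rewrite (lt_le_trans h3 h1) (le_lt_trans h2) //; apply: le_lt_trans (hc i).
  by rewrite lerD2l ge_min lexx.
rewrite /eball /= subr0 -[y](subrK u) (le_trans (enormD _ _)) // -lerBrDr.
apply: (@le_trans _ _ (n.+1%:R * c')%R).
  apply: enorm_le_sup; first exact: ltW.
  by move=> i; rewrite !mxE; have /andP[h1 h2] := hy i; rewrite ger0_norm; lra.
by rewrite mulrC -ler_pdivlMr // ge_min lexx orbT.
Qed.

(** An open box around the closed unit ball stands in for the ball, since [W_unif] speaks of open
    boxes only. *)
Lemma unit_uniform_bounded : P (W @^-1` obox (const_mx (-2)%R) (const_mx 2%R)) = 1.
Proof.
have [v v0 Vv] := unit_ball_volume n_gt0.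
have := W_unif (const_mx (-2)%R) (const_mx 2%R).
rewrite setIidr; last first.
  rewrite /eball => y /=; rewrite subr0 => hy i; rewrite !mxE.
  by have := le_trans (enorm_coord y i) hy; rewrite ler_norml => /andP[h1 h2]; lra.
rewrite Vv; have : P (W @^-1` obox (const_mx (-2)%R) (const_mx 2%R)) \is a fin_num.
  exact: fin_num_measure.
move=> /fineK <-; rewrite -EFinM => -[] /eqP.
by rewrite -{2}[v]mul1r -subr_eq0 -mulrBl mulf_eq0 subr_eq0 (gt_eqF v0) orbF => /eqP ->.
Qed.
End UniformBall.

(** * A mean value inequality by mollification *)

Lemma increment_le_lipschitz {R : realType} (phi : R -> R) (M c : R) : 0 <= M ->
  (forall r s, 0 <= r <= 1 -> 0 <= s <= 1 -> phi s - phi r <= M * `|s - r|) ->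
  (forall s d, 0 <= s < 1 -> 0 < d ->
    exists2 t, 0 < t < d & phi (s + t) - phi s <= c * t) ->
  phi 1 - phi 0 <= c.
Proof.
move=> M0 lip step; apply: increment_le step => s e /andP[s0 s1] e0.
have M1 : 0 < M + 1 by rewrite ltr_wpDl.
exists (e / (M + 1)); first by rewrite divr_gt0.
move=> r r0 /andP[h1 h2]; apply: (le_trans (lip r s _ _)).
- by rewrite r0 /=; lra.
- by rewrite ltW.
rewrite gtr0_norm ?subr_gt0 //.
have : s - r < e / (M + 1) by lra.
rewrite ltr_pdivlMr // => h3; lra.
Qed.

Section Mollification.
Context {R : realType} {n : nat}.
Context {d : measure_display} {Omega : measurableType d} (P : probability Omega R).
Variable W : Omega -> 'rV[R]_n.
Hypothesis W_meas : forall a b, measurable (W @^-1` obox a b).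
Local Notation B := (W @^-1` obox (const_mx (-2)%R) (const_mx 2%R)).
Hypothesis W_bounded : P B = 1%E.

Lemma locally_lipschitz_near (f : 'rV[R]_n -> R) x (r : R) :
  locally_lipschitz f -> 0 < r ->
  exists2 a, 0 < a & forall y, enorm (y - x) < a -> `|f y - f x| < r.
Proof.
move=> lf r0; have [e [L [e0 he]]] := lf x.
have L1 : 0 < `|L| + 1 by rewrite ltr_wpDl.
exists (Num.min e (r / (`|L| + 1))); first by rewrite lt_min e0 divr_gt0.
move=> y; rewrite lt_min => /andP[ye]; rewrite ltr_pdivlMr // => yr.
apply: (le_lt_trans (he _ _ _ _)); rewrite /eball /= ?(ltW ye) //.
  by rewrite subrr enorm0 ltW.
have : L * enorm (y - x) <= `|L| * enorm (y - x).
  by rewrite ler_wpM2r ?enorm_ge0 // ler_norm.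
have := enorm_ge0 (y - x); lra.
Qed.

Lemma affine_near (z y : 'rV[R]_n) (e a : R) : 0 < a ->
  exists2 b, 0 < b & forall y', enorm (y' - y) < b ->
    enorm (z + e *: y' - (z + e *: y)) < a.
Proof.
move=> a0; have e1 : 0 < `|e| + 1 by rewrite ltr_wpDl.
exists (a / (`|e| + 1)); first by rewrite divr_gt0.
move=> y'; rewrite ltr_pdivlMr // => h.
rewrite opprD addrACA subrr add0r -scalerBr enormZ.
by have := enorm_ge0 (y' - y); lra.
Qed.

Lemma open_affine_preimage (O : set 'rV[R]_n) z (e : R) : open O ->
  open [set y | O (z + e *: y)].
Proof.
rewrite !openE => oO y /= /oO /nbhs_enorm[a a0 ha].
have [b b0 hb] := affine_near z y e a0.
by apply/nbhs_enorm; exists b => // y' /hb; exact: ha.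
Qed.

Lemma open_superlevel (f : 'rV[R]_n -> R) (a : R) : locally_lipschitz f ->
  open [set y | a < f y].
Proof.
move=> lf; rewrite openE => y /= ay; apply/nbhs_enorm.
have [|b b0 hb] := @locally_lipschitz_near f y (f y - a) lf.
  by rewrite subr_gt0.
exists b => // y' /hb /=; rewrite ltr_norml => /andP[h _]; lra.
Qed.

Lemma measurable_lipschitz_comp (f : 'rV[R]_n -> R) z (e : R) :
  locally_lipschitz f -> measurable_fun B (fun w => f (z + e *: W w)).
Proof.
move=> lf; apply: (measurability _ (RGenOInfty.measurableE R)) => //.
move=> /= _ [_ [a ->] <-]; apply: measurableI; first exact: W_meas.
rewrite (_ : _ @^-1` _ = W @^-1` [set y | [set y | a < f y] (z + e *: y)]).
  apply: measurable_preimage_open => //; apply: open_affine_preimage.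
  exact: open_superlevel.
by apply/seteqP; split => w /=; rewrite in_itv /= andbT.
Qed.

Lemma Rintegral_le_cst (g : Omega -> R) (K : R) :
  P.-integrable B (EFin \o g) -> (forall w, B w -> g w <= K) ->
  \int[P]_(w in B) g w <= K.
Proof.
move=> ig gK; apply: (@le_trans _ _ (\int[P]_(w in B) K)).
  apply: le_Rintegral => //; exact: finite_measure_integrable_cst.
by rewrite Rintegral_cst // [X in fine X]W_bounded mulr1.
Qed.

Lemma Rintegral_ge_cst (g : Omega -> R) (K : R) :
  P.-integrable B (EFin \o g) -> (forall w, B w -> K <= g w) ->
  K <= \int[P]_(w in B) g w.
Proof.
move=> ig gK; apply: (@le_trans _ _ (\int[P]_(w in B) K)).
  by rewrite Rintegral_cst // [X in fine X]W_bounded mulr1.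
apply: le_Rintegral => //; exact: finite_measure_integrable_cst.
Qed.

Variables (f : 'rV[R]_n -> R) (D : set 'rV[R]_n).
Hypotheses (f_lip : locally_lipschitz f) (D_open : open D).
Hypothesis f_diff : forall x, D x -> differentiable f x.
Hypothesis W_null : forall (z : 'rV[R]_n) (e : R), 0 < e ->
  P.-negligible [set w | ~ D (z + e *: W w)].

Lemma mollified_integrable (xb z : 'rV[R]_n) (r L e : R) : 0 <= r -> 0 <= L ->
  (forall y z, eball xb r y -> eball xb r z -> `|f y - f z| <= L * enorm (y - z)) ->
  (forall w, B w -> enorm (z + e *: W w - xb) < r) ->
  P.-integrable B (EFin \o (fun w => f (z + e *: W w))).
Proof.
move=> r0 L0 lip inr; apply: measurable_bounded_integrable => //.
- by rewrite [X in (X < _)%E]W_bounded ltry.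
- exact: measurable_lipschitz_comp.
exists (`|f xb| + L * r); split; first exact: num_real.
move=> M hM w Bw; apply: le_trans (ltW hM).
have hw := ltW (inr w Bw).
rewrite /= -[f _](subrK (f xb)) addrC (le_trans (ler_normD _ _)) // lerD2l.
apply: (le_trans (lip _ _ hw _)); first by rewrite /eball /= subrr enorm0.
by rewrite ler_wpM2l.
Qed.

(* Almost surely the base point lies in [D], where the difference quotients
   converge; Fatou's lemma applied to [N - q j >= 0] bounds the lower Dini derivative
   of the mollification by [c]. *)
Lemma mollified_mean_value (xb x h : 'rV[R]_n) (r L e c : R) : 0 <= r -> 0 <= L -> 0 < e ->
  (forall y z, eball xb r y -> eball xb r z -> `|f y - f z| <= L * enorm (y - z)) ->
  (forall s w, 0 <= s <= 1 -> B w -> enorm (x + s *: h + e *: W w - xb) < r) ->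
  (forall y, D y -> enorm (y - xb) < r -> edot (grad f y) h <= c) ->
  \int[P]_(w in B) f (x + 1 *: h + e *: W w) -
  \int[P]_(w in B) f (x + 0 *: h + e *: W w) <= c.
Proof.
move=> r0 L0 e0 lip inr gc.
pose psi (s : R) (w : Omega) := f (x + s *: h + e *: W w).
have mpsi s : measurable_fun B (psi s) by exact: measurable_lipschitz_comp.
have ipsi s : 0 <= s <= 1 -> P.-integrable B (EFin \o psi s).
  by move=> hs; apply: (mollified_integrable r0 L0 lip) => w; exact: inr.
have psiB s1 s2 : 0 <= s1 <= 1 -> 0 <= s2 <= 1 -> forall w, B w ->
    `|psi s2 w - psi s1 w| <= L * enorm h * `|s2 - s1|.
  move=> h1 h2 w Bw; apply: (le_trans (lip _ _ (ltW (inr _ _ h2 Bw)) (ltW (inr _ _ h1 Bw)))).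
  rewrite (_ : _ - _ = (s2 - s1) *: h) ?enormZ ?[`|_| * _]mulrC ?mulrA //.
  by apply/rowP => i; rewrite !mxE; ring.
have intB s1 s2 : 0 <= s1 <= 1 -> 0 <= s2 <= 1 ->
    \int[P]_(w in B) psi s2 w - \int[P]_(w in B) psi s1 w =
    \int[P]_(w in B) (psi s2 w - psi s1 w).
  by move=> h1 h2; rewrite RintegralB //; exact: ipsi.
have iB s1 s2 : 0 <= s1 <= 1 -> 0 <= s2 <= 1 ->
    P.-integrable B (EFin \o (fun w => psi s2 w - psi s1 w)).
  move=> h1 h2; have := integrableB (W_meas _ _) (ipsi _ h2) (ipsi _ h1).
  by apply: eq_integrable.
have N0 : 0 <= L * enorm h by rewrite mulr_ge0 ?enorm_ge0.
apply/ler_addgt0Pr => eta eta0.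
apply: (@increment_le_lipschitz _ (fun s => \int[P]_(w in B) psi s w) (L * enorm h)) => //.
  move=> s1 s2 h1 h2; rewrite intB //; apply: Rintegral_le_cst; first exact: iB.
  by move=> w Bw; apply: le_trans (psiB _ _ h1 h2 _ Bw); exact: ler_norm.
(* If every short step raised the mollification by more than [c + eta] per unit length, all
   integrals of [phi j] would be at most [N - c - eta], whereas Fatou's lemma bounds their lower
   limit from below by [N - c]. *)
move=> s e' /andP[s0 s1] e'0; apply: contrapT => none.
pose tau := Num.min e' (1 - s) / 2.
have m0 : 0 < Num.min e' (1 - s) by rewrite lt_min e'0 subr_gt0.
have tau0 : 0 < tau by rewrite divr_gt0.
have [taue taus] : tau < e' /\ tau < 1 - s.
  have : tau < Num.min e' (1 - s) by rewrite /tau; lra.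
  by rewrite lt_min => /andP.
pose t (j : nat) := tau / j.+1%:R.
have t0 j : 0 < t j by rewrite divr_gt0.
have ttau j : t j <= tau by rewrite ler_pdivrMr // ler_peMr ?ler1n // ltW.
have hs : 0 <= s <= 1 by rewrite s0 ltW.
have hst j : 0 <= s + t j <= 1.
  by have := t0 j; have := ttau j; move=> h1 h2; apply/andP; split; lra.
pose N := L * enorm h.
pose q j w := (t j)^-1 * (psi (s + t j) w - psi s w).
pose phi j w := (N - q j w)%:E.
have phi0 j w : B w -> (0 <= phi j w)%E.
  move=> Bw; rewrite lee_fin subr_ge0 /q ler_pdivrMl //.
  have := psiB _ _ hs (hst j) _ Bw; rewrite addrAC subrr add0r (gtr0_norm (t0 j)) mulrC.
  by apply: le_trans; exact: ler_norm.
have mphi j : measurable_fun B (phi j).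
  apply/measurable_EFinP; apply: measurable_funB => //.
  by apply: measurable_funM => //; apply: measurable_funB.
have iq j : P.-integrable B (EFin \o q j).
  have := integrableZl (W_meas _ _) (t j)^-1 (iB _ _ hs (hst j)).
  by apply: eq_integrable.
have intphi j : (\int[P]_(w in B) phi j w <= (N - c - eta)%:E)%E.
  have ip : P.-integrable B (phi j).
    have := integrableB (W_meas _ _) 
      (finite_measure_integrable_cst P N (W_meas (const_mx (-2)) (const_mx 2))) (iq j).
    by apply: eq_integrable.
  rewrite -[leLHS]fineK; last exact: integrable_fin_num.
  rewrite lee_fin -/(Rintegral P B (fun w => N - q j w)) RintegralB //; last first.
    exact: finite_measure_integrable_cst.
  rewrite Rintegral_cst // [X in fine X]W_bounded mulr1 RintegralZl //; last exact: iB.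
  rewrite -intB // -addrA lerD2l -opprD lerN2 ler_pdivlMl //.
  rewrite mulrC ltW // ltNge; apply/negP => bad; apply: none.
  by exists (t j) => //; rewrite t0 (le_lt_trans (ttau j)).
pose y w := x + s *: h + e *: W w.
pose B' := B `&` [set w | D (y w)].
have mD : measurable [set w | D (y w)].
  rewrite (_ : [set _ | _] = W @^-1` [set z | D (x + s *: h + e *: z)]) //.
  by apply: measurable_preimage_open => //; exact: open_affine_preimage.
have mB' : measurable B' by apply: measurableI.
have PB' : P B' = 1%E.
  have : P (~` [set w | D (y w)]) = 0%E.
    by apply: measure_negligible; [exact: measurableC|exact: W_null].
  rewrite -W_bounded => nD.
  rewrite -[in RHS](setIT B) -(setUv [set w | D (y w)]) setIUr measureU //; last 2 first.
  - by apply: measurableI => //; exact: measurableC.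
  - by rewrite setIACA setICr setI0.
  rewrite [X in (_ + X)%E](_ : _ = 0%E) ?adde0 //.
  apply/eqP; rewrite -measure_le0 -nD; apply: le_measure; rewrite ?inE //.
    by apply: measurableI => //; exact: measurableC.
  exact: measurableC.
(* The maximum with 0 keeps the constant integrand nonnegative, as the comparison of nonnegative
   integrals requires. *)
have liminf_phi w : B' w -> ((Num.max (N - c) 0)%:E <= limn_einf (phi ^~ w))%E.
  move=> [Bw Dw].
  have yr : enorm (y w - xb) < r by exact: inr.
  have : (phi ^~ w) @ \oo --> (N - edot (grad f (y w)) h)%:E.
    apply: cvg_EFin; first exact: nearW.
    apply: cvgB; first exact: cvg_cst.
    apply/cvgrPdist_le => a a0.
    have [b b0 hb] := directional_derivative h (f_diff Dw) a0.
    exists (Num.truncn (tau / b)) => // j /= jb.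
    have tb : t j < b.
      rewrite ltr_pdivrMr // -ltr_pdivrMl // mulrC (lt_le_trans (truncnS_gt _)) //.
      by rewrite ler_nat ltnS.
    have := hb (t j); rewrite gtr0_norm // => /(_ tb).
    have -> : f (y w + t j *: h) = psi (s + t j) w.
      by congr f; apply/rowP => i; rewrite !mxE; ring.
    rewrite -/(psi s w) distrC -(ler_pdivrMr _ _ (t0 j)) => hq.
    apply: le_trans hq; rewrite -[X in _ / X](gtr0_norm (t0 j)) -normfV -normrM.
    by rewrite mulrBl [_ * _ / _]mulrAC divff ?gt_eqF // mul1r mulrC.
  move=> hc; have [-> _] := cvg_limn_einf_sup hc.
  rewrite lee_fin ge_max lerD2l lerN2 gc //= subr_ge0.
  apply: (le_trans (cauchy_schwarz _ _)); rewrite ler_wpM2r ?enorm_ge0 //.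
  exact: grad_bound L0 lip (f_diff Dw) yr.
have mphi' j : measurable_fun B' (phi j).
  by apply: measurable_funS (mphi j) => //; exact: subIsetl.
have phi0' j w : B' w -> (0 <= phi j w)%E by move=> [Bw _]; exact: phi0.
suff : (N - c <= N - c - eta)%R by lra.
rewrite -lee_fin.
apply: (@le_trans _ _ (\int[P]_(w in B') (Num.max (N - c) 0)%:E)%E).
  by rewrite integral_cst // [X in (_ * X)%E]PB' mule1 lee_fin le_max lexx.
apply: (@le_trans _ _ (\int[P]_(w in B') limn_einf (phi ^~ w))%E).
  apply: ge0_le_integral => //.
  - by move=> w _; rewrite lee_fin le_max lexx orbT.
  - rewrite (_ : (fun w => _) = (fun w => - limn_esup (fun j => - phi j w))%E); last first.
      by apply/funext => w; rewrite limn_esupN oppeK.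
    apply: (measurableT_comp (f := -%E)) => //; apply: measurable_fun_limn_esup => j.
    exact: (measurableT_comp (f := -%E)).
apply: (le_trans (fatou P mB' mphi' phi0')).
rewrite limn_einf_lim; apply: lime_le; first exact: is_cvg_einfs.
apply: nearW => j; apply: (@le_trans _ _ (\int[P]_(w in B') phi j w)%E).
  by apply: ereal_inf_lbound; exists j => //=.
apply: (le_trans _ (intphi j)); apply: ge0_subset_integral => //.
  exact: phi0.
exact: subIsetl.
Qed.
Lemma mean_value_ball (xb x h : 'rV[R]_n) (r c : R) :
  enorm (x - xb) < r -> enorm (x + h - xb) < r ->
  (forall y, D y -> enorm (y - xb) < r -> edot (grad f y) h <= c) ->
  f (x + h) - f x <= c.
Proof.
move=> xr xhr gc.
have r0 : 0 <= r by rewrite (le_trans (enorm_ge0 _) (ltW xr)).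
have [L L0 lip] := lipschitz_on_eball xb r f_lip.
pose M : R := n.+1%:R * 2.
have M0 : 0 < M by rewrite mulr_gt0.
have WM w : B w -> enorm (W w) <= M.
  move=> Bw; apply: enorm_le_sup => // i.
  by have := Bw i; rewrite !mxE ler_norml => /andP[h1 h2]; rewrite !ltW.
pose rho := Num.max (enorm (x - xb)) (enorm (x + h - xb)).
have rhor : 0 < r - rho by rewrite subr_gt0 gt_max xr.
apply/ler_addgt0Pr => eta eta0.
have LM : 0 < 2 * (L + 1) * M by rewrite !mulr_gt0 // ltr_wpDl.
(* The first term keeps the perturbed segment inside the ball of radius [r]; the second makes the
   errors [L * (e * M)] at the two endpoints add up to at most [eta]. *)
pose e := Num.min ((r - rho) / (2 * M)) (eta / (2 * (L + 1) * M)).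
have e0 : 0 < e by rewrite lt_min !divr_gt0 // mulr_gt0.
have eM : e * M < r - rho.
  have : e <= (r - rho) / (2 * M) by rewrite ge_min lexx.
  rewrite ler_pdivlMr ?mulr_gt0 // => h1; lra.
have LeM : 2 * (L * (e * M)) <= eta.
  have : e <= eta / (2 * (L + 1) * M) by rewrite ge_min lexx orbT.
  rewrite ler_pdivlMr // => h1; have : 0 < e * M by rewrite mulr_gt0.
  lra.
have inr s w : 0 <= s <= 1 -> B w -> enorm (x + s *: h + e *: W w - xb) < r.
  move=> hs Bw; rewrite addrAC (le_lt_trans (enormD _ _)) // enormZ gtr0_norm //.
  have h1 : e * enorm (W w) <= e * M by rewrite ler_pM2l // WM.
  have : eball xb rho (x + s *: (x + h - x)).
    by apply: eball_convex => //; rewrite /eball /= le_max lexx ?orbT.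
  rewrite addrAC subrr add0r /eball /= => h2; lra.
have h01 : (0 <= 0 :> R) && (0 <= 1 :> R) by rewrite lexx ler01.
have h11 : (0 <= 1 :> R) && (1 <= 1 :> R) by rewrite lexx ler01.
have close z w : eball xb r z -> B w -> enorm (z + e *: W w - xb) < r ->
    `|f (z + e *: W w) - f z| <= L * (e * M).
  move=> zr Bw zw; apply: (le_trans (lip _ _ (ltW zw) zr)).
  rewrite addrAC subrr add0r enormZ gtr0_norm // ler_wpM2l //.
  by rewrite ler_pM2l // WM.
have := mollified_mean_value r0 L0 e0 lip inr gc.
have i0 := mollified_integrable r0 L0 lip (fun w => inr 0 w h01).
have i1 := mollified_integrable r0 L0 lip (fun w => inr 1 w h11).
have c0 : \int[P]_(w in B) f (x + 0 *: h + e *: W w) <= f x + L * (e * M).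
  apply: Rintegral_le_cst => // w Bw.
  have := inr 0 w h01 Bw; rewrite scale0r addr0 => /(close _ _ (ltW xr) Bw).
  by rewrite ler_norml => /andP[_]; lra.
have c1 : f (x + h) - L * (e * M) <= \int[P]_(w in B) f (x + 1 *: h + e *: W w).
  apply: Rintegral_ge_cst => // w Bw.
  have := inr 1 w h11 Bw; rewrite scale1r => /(close _ _ (ltW xhr) Bw).
  by rewrite ler_norml => /andP[+ _]; lra.
lra.
Qed.

End Mollification.

(** * Convex hulls *)

Section Convexity.
Context {R : realType} {n : nat}.
Implicit Types (S : set 'rV[R]_n) (v : 'rV[R]_n).

Lemma conv_mono S S' : S `<=` S' -> Defs.conv S `<=` Defs.conv S'.
Proof.
by move=> SS' v [k [p [l [Sp h]]]]; exists k, p, l; split => // i; exact: SS'.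
Qed.

Lemma sub_conv S : S `<=` Defs.conv S.
Proof.
move=> v Sv; exists 1%N, (fun=> v), (fun=> 1); split => //; split => //.
by rewrite !big_ord1 scale1r.
Qed.

Lemma conv_edot_ge S (h v : 'rV[R]_n) (c : R) :
  (forall y, S y -> c <= edot y h) -> Defs.conv S v -> c <= edot v h.
Proof.
move=> Sc [k [p [l [Sp [l0 [l1 ->]]]]]]; rewrite edot_suml.
rewrite -[leLHS]mul1r -l1 mulr_suml; apply: ler_sum => i _.
by rewrite edotZl ler_wpM2l // Sc.
Qed.

Lemma conv_enorm_le S v (c : R) :
  (forall y, S y -> enorm y <= c) -> Defs.conv S v -> enorm v <= c.
Proof.
move=> Sc [k [p [l [Sp [l0 [l1 ->]]]]]]; apply: (le_trans (enorm_sum _)).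
rewrite -[leRHS]mul1r -l1 mulr_suml; apply: ler_sum => i _.
by rewrite enormZ ger0_norm // ler_wpM2l // Sc.
Qed.

Lemma conv_segment S u v (s : R) : Defs.conv S u -> Defs.conv S v -> 0 <= s <= 1 ->
  Defs.conv S (u + s *: (v - u)).
Proof.
move=> [k [p [l [Sp [l0 [l1 ->]]]]]] [k' [p' [l' [Sp' [l0' [l1' ->]]]]]] /andP[s0 s1].
pose q (i : 'I_(k + k')) := match fintype.split i with inl j => p j | inr j => p' j end.
pose m (i : 'I_(k + k')) :=
  match fintype.split i with inl j => (1 - s) * l j | inr j => s * l' j end.
exists (k + k')%N, q, m; split; first by move=> i; rewrite /q; case: fintype.split.
split; first by move=> i; rewrite /m; case: fintype.split => j; rewrite mulr_ge0 // subr_ge0.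
rewrite !big_split_ord /=.
have mL j : m (lshift k' j) = (1 - s) * l j by rewrite /m (unsplitK (inl j)).
have mR j : m (rshift k j) = s * l' j by rewrite /m (unsplitK (inr j)).
have qL j : q (lshift k' j) = p j by rewrite /q (unsplitK (inl j)).
have qR j : q (rshift k j) = p' j by rewrite /q (unsplitK (inr j)).
split.
  under eq_bigr do rewrite mL; under [X in _ + X]eq_bigr do rewrite mR.
  by rewrite -!mulr_sumr l1 l1' !mulr1 subrK.
under [X in _ = X + _]eq_bigr do rewrite mL qL -scalerA.
under [X in _ = _ + X]eq_bigr do rewrite mR qR -scalerA.
rewrite -!scaler_sumr; move: (\sum_i _) (\sum_i _) => a b.
by apply/rowP => i; rewrite !mxE; ring.
Qed.

(* An affine dependence among more than n+1 points lets one of the weights be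
   driven to 0. *)
Lemma conv_drop_point S v (k : nat) (p : 'I_k.+1 -> 'rV[R]_n) (l : 'I_k.+1 -> R) :
  (n < k)%N -> (forall i, S (p i)) -> (forall i, 0 <= l i) -> \sum_i l i = 1 ->
  v = \sum_i l i *: p i ->
  exists (p' : 'I_k -> 'rV[R]_n) (l' : 'I_k -> R),
    (forall i, S (p' i)) /\ (forall i, 0 <= l' i) /\
    \sum_i l' i = 1 /\ v = \sum_i l' i *: p' i.
Proof.
move=> nk Sp l0 l1 vE.
(* A left kernel vector of the matrix with rows [(p i, 1)] is an affine dependence: the last column
   makes its entries sum to 0. It exists because [k.+1] exceeds the number of columns. *)
pose A : 'M[R]_(k.+1, n + 1) := \matrix_i row_mx (p i) (1%:M : 'rV_1).
have [m [m_neq0 mA]] : exists m : 'rV[R]_k.+1, m != 0 /\ m *m A = 0.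
  have : kermx A != 0.
    rewrite -mxrank_eq0 mxrank_ker subn_eq0 -ltnNge.
    by rewrite (leq_ltn_trans (rank_leq_col A)) // addn1 ltnS.
  move=> /rowV0Pn[m /sub_kermxP mA m0]; by exists m.
have msum : \sum_i m ord0 i = 0.
  have := congr1 (fun B : 'rV_(n + 1) => B ord0 (rshift n ord0)) mA.
  rewrite mxE [RHS]mxE => h; rewrite -[RHS]h; apply: eq_bigr => i _.
  by rewrite [A i _]mxE row_mxEr mxE mulr1n mulr1.
have mp : \sum_i m ord0 i *: p i = 0.
  apply/rowP => j.
  have := congr1 (fun B : 'rV_(n + 1) => B ord0 (lshift 1 j)) mA.
  rewrite mxE [RHS]mxE => h; rewrite summxE [RHS]mxE -[RHS]h; apply: eq_bigr => i _.
  by rewrite [A i _]mxE row_mxEl !mxE.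
have [i0 mi0] : exists i, 0 < m ord0 i.
  apply: contrapT => none; case/eqP: m_neq0; apply/rowP => i; rewrite mxE.
  have m_le0 j : 0 <= - m ord0 j.
    by rewrite oppr_ge0 leNgt; apply/negP => h; apply: none; exists j.
  have : \sum_j - m ord0 j == 0 by rewrite sumrN msum oppr0.
  rewrite psumr_eq0 // => /allP/(_ i (mem_index_enum _)) /=.
  by rewrite oppr_eq0 => /eqP.
(* Ratio test: the minimal ratio [s] is the largest multiple of [m] that can be subtracted with all
   weights staying nonnegative, and it cancels the weight of [i1]. *)
pose i1 := [arg min_(i < i0 | 0 < m ord0 i) (l i / m ord0 i)]%O.
have [mi1 mini1] : 0 < m ord0 i1 /\ forall j, 0 < m ord0 j ->
    l i1 / m ord0 i1 <= l j / m ord0 j.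
  by rewrite /i1; case: arg_minP.
pose s := l i1 / m ord0 i1.
pose l' i := l i - s * m ord0 i.
have l'i1 : l' i1 = 0 by rewrite /l' /s divfK ?subrr // gt_eqF.
have s0 : 0 <= s by rewrite divr_ge0 // ltW.
exists (fun i => p (lift i1 i)), (fun i => l' (lift i1 i)).
split; first by move=> i.
split.
  move=> i; rewrite /l' subr_ge0; case: (ltP 0 (m ord0 (lift i1 i))) => h.
    by rewrite -ler_pdivlMr // mini1.
  by apply: le_trans (l0 _); rewrite mulr_ge0_le0.
split.
  have : \sum_i l' i = 1 by rewrite sumrB -mulr_sumr msum mulr0 subr0.
  by rewrite (bigD1_ord i1) //= l'i1 add0r.
have : \sum_i l' i *: p i = v.
  under eq_bigr do rewrite scalerBl -scalerA.
  by rewrite sumrB -scaler_sumr mp scaler0 subr0.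
by rewrite (bigD1_ord i1) //= l'i1 scale0r add0r => <-.
Qed.

(** Exactly [m] points, rather than at most [n + 1], are produced in order to match the number of
    samples; shorter combinations are padded with weight 0. *)
Lemma caratheodory S v (m : nat) : (n < m)%N -> Defs.conv S v ->
  exists (p : 'I_m -> 'rV[R]_n) (l : 'I_m -> R),
    (forall i, S (p i)) /\ (forall i, 0 <= l i) /\
    \sum_i l i = 1 /\ v = \sum_i l i *: p i.
Proof.
move=> nm [k]; elim: k => [|k IH].
  move=> [p [l [_ [_ [+ _]]]]]; rewrite big_ord0 => /esym/eqP.
  by rewrite oner_eq0.
have [mk|km] := ltnP m k.+1.
  move=> [p [l [Sp [l0 [l1 vE]]]]]; apply: IH.
  exact: conv_drop_point (leq_trans nm mk) Sp l0 l1 vE.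
move=> [p [l [Sp [l0 [l1 vE]]]]].
pose q (i : 'I_m) := p (inord i).
pose l' (i : 'I_m) := if (i <= k)%N then l (inord i) else 0.
exists q, l'; split; first by move=> i; exact: Sp.
split; first by move=> i; rewrite /l'; case: ifP.
have red (T : nmodType) (F : nat -> T) :
    \sum_(i < m) (if (i <= k)%N then F i else 0) = \sum_(i < k.+1) F i.
  by rewrite (big_ord_widen m F km) [RHS]big_mkcond.
split.
  rewrite /l' (red _ (fun i => l (inord i))) -l1; apply: eq_bigr => i _.
  by rewrite inord_val.
rewrite vE; transitivity (\sum_(i < k.+1) l (inord i) *: p (inord i)).
  by apply: eq_bigr => i _; rewrite inord_val.
rewrite -(red _ (fun i => l (inord i) *: p (inord i))); apply: eq_bigr => i _.
by rewrite /l'; case: ifP; rewrite ?scale0r.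
Qed.

End Convexity.

(** * Sample configurations forcing a long step *)

Section Armijo.
Context {R : realType} {n : nat}.
Variables (f : 'rV[R]_n -> R) (D : set 'rV[R]_n).
Hypotheses (f_lip : locally_lipschitz f) (D_open : open D) (f_C1 : C1_on f D).
Hypothesis mean_value : forall (xb x h : 'rV[R]_n) (r c : R),
  enorm (x - xb) < r -> enorm (x + h - xb) < r ->
  (forall y, D y -> enorm (y - xb) < r -> edot (grad f y) h <= c) ->
  f (x + h) - f x <= c.

(** The convex hull of this set plays the role of the Goldstein [e]-subdifferential at [xb]. *)
Definition nearby_grads (xb : 'rV[R]_n) (e : R) : set 'rV[R]_n :=
  [set v | exists y, [/\ D y, enorm (y - xb) < e & v = grad f y]].

(** Without such gradients [mean_value] would apply vacuously to the zero step with the bound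
    [-1]. *)
Lemma nearby_grads_nonempty xb e : 0 < e -> nearby_grads xb e !=set0.
Proof.
move=> e0; apply: contrapT => none.
have := @mean_value xb xb 0 e (-1).
rewrite addr0 !subrr enorm0 => /(_ e0 e0) h.
have : 0 <= -1 :> R by apply: h => y Dy yx; case: none; exists (grad f y), y.
lra.
Qed.

(* [x] is only a differentiability point, possibly outside [D]. *)
Lemma nearby_grads_edot xb e x p k : enorm (x - xb) < e -> differentiable f x ->
  (forall v, nearby_grads xb e v -> k <= edot v p) -> k <= edot (grad f x) p.
Proof.
move=> xe dx hk; apply/ler_addgt0Pr => a a0.
(* The derivative at [x] along [- p] is compared with [mean_value] on a short segment inside the
   ball; this carries the bound from points of [D] to [x]. *)
have [b b0 hb] := directional_derivative (- p) dx a0.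
have p1 : 0 < enorm p + 1 by rewrite ltr_wpDl ?enorm_ge0.
have xe' : 0 < e - enorm (x - xb) by rewrite subr_gt0.
pose t := Num.min b ((e - enorm (x - xb)) / (enorm p + 1)) / 2.
have m0 : 0 < Num.min b ((e - enorm (x - xb)) / (enorm p + 1)).
  by rewrite lt_min b0 divr_gt0.
have t0 : 0 < t by rewrite divr_gt0.
have [tb] : t < b /\ t < (e - enorm (x - xb)) / (enorm p + 1).
  have : t < Num.min b ((e - enorm (x - xb)) / (enorm p + 1)) by rewrite /t; lra.
  by rewrite lt_min => /andP.
rewrite ltr_pdivlMr // => te.
have := hb t; rewrite gtr0_norm // => /(_ tb); rewrite edotNr => h1.
have h2 : f (x + t *: (- p)) - f x <= - (t * k).
  apply: (mean_value xe).
    rewrite addrAC (le_lt_trans (enormD _ _)) // enormZ enormN gtr0_norm //; lra.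
  move=> y Dy ye; rewrite edotZr edotNr mulrN lerN2 ler_pM2l //.
  by apply: hk; exists y.
rewrite -(ler_pM2l t0); move: h1; rewrite ler_norml => /andP[h1 _]; lra.
Qed.

(* Approximate variational inequality of the projection of 0 on [conv G]; an
   exact projection would need the closure of [conv G]. *)
Lemma near_min_norm (G : set 'rV[R]_n) (L s : R) : G !=set0 ->
  (forall v, G v -> enorm v <= L) -> 0 < s <= 1 ->
  exists2 p, Defs.conv G p & forall v, G v ->
    enorm p ^+ 2 - s * ((1 + 4 * L ^+ 2) / 2) <= edot v p.
Proof.
move=> [v0 Gv0] GL /andP[s0 s1].
pose A := [set enorm v ^+ 2 | v in Defs.conv G].
have lbA : has_lbound A by exists 0 => _ [v _ <-]; rewrite exprn_ge0 ?enorm_ge0.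
have infA : has_inf A by split => //; exists (enorm v0 ^+ 2), v0 => //; exact: sub_conv.
(* The infimum is approached up to [s ^+ 2]: comparing [p] with [p + s *: (v - p)] and dividing by
   [2 * s] then leaves an error of order [s]. *)
have s2 : 0 < s ^+ 2 by rewrite exprn_gt0.
have [_ [p Gp <-]] := inf_adherent s2 infA => hp; exists p => // v Gv.
have Gs : Defs.conv G (p + s *: (v - p)).
  by apply: conv_segment => //; [exact: sub_conv|rewrite ltW].
have : inf A <= enorm (p + s *: (v - p)) ^+ 2.
  by apply: ge_inf => //; exists (p + s *: (v - p)).
have L0 : 0 <= L by rewrite (le_trans (enorm_ge0 _) (GL _ Gv0)).
have vp : edot (v - p) (v - p) <= 4 * L ^+ 2.
  rewrite -enorm_sqr.
  have : enorm (v - p) <= 2 * L.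
    rewrite (le_trans (enormD _ _)) // enormN.
    have := GL _ Gv; have := conv_enorm_le GL Gp; lra.
  rewrite -(@ler_pXn2r _ 2) ?nnegrE ?enorm_ge0 ?mulr_ge0 // => h.
  by apply: le_trans h _; rewrite exprMn -natrX.
rewrite !enorm_sqr edotDl !edotDr !(edotZl, edotZr) edotDr edotNr.
move: hp; rewrite -enorm_sqr enorm_sqr (edotC _ p) edotDr edotNr => hp hi.
have h2 : s * (s * edot (v - p) (v - p)) <= s * (s * (4 * L ^+ 2)).
  by rewrite !ler_pM2l.
rewrite -(ler_pM2l s0) [edot v p]edotC; lra.
Qed.

Lemma small_power (gamma e : R) : 0 < gamma < 1 -> 0 < e -> exists j, gamma ^+ j < e.
Proof.
move=> /andP[g0 g1] e0.
have : (fun j : nat => gamma ^+ j) @ \oo --> (0 : R).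
  by apply: cvg_expr; rewrite gtr0_norm.
move=> /cvgrPdist_lt/(_ e e0)[j _ /(_ j (leqnn j))].
by rewrite sub0r normrN gtr0_norm ?exprn_gt0 //; exists j.
Qed.

Lemma continuous_grad_near y e : D y -> 0 < e -> exists2 a, 0 < a &
  forall y', enorm (y' - y) < a -> D y' /\ enorm (grad f y' - grad f y) < e.
Proof.
move=> Dy e0.
have /nbhs_enorm[a a0 ha] : nbhs y D by exact: open_nbhs_nbhs.
have /(cvg_enorm (nbhs_filter y))/(_ e e0)/nbhs_enorm[b b0 hb] := f_C1.2 y Dy.
exists (Num.min a b); first by rewrite lt_min a0.
by move=> y'; rewrite lt_min => /andP[/ha Dy' /hb].
Qed.

(** The direction [g] must be close to [p], a nearly shortest element of the hull of nearby
    gradients: it is almost as short as [p], and [edot g p] is almost at least [enorm p ^+ 2]. Hence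
    every nearby gradient has a product with [g] exceeding [beta * enorm g ^+ 2], and [mean_value]
    yields the decrease for a step chosen before [x], [U] and [g]. *)
Lemma good_samples (m : nat) (xb : 'rV[R]_n) (eps nu beta gamma : R) : (n < m)%N ->
  0 < eps -> 0 < nu -> 0 < beta < 1 -> 0 < gamma < 1 ->
  exists (u : 'I_m -> 'rV[R]_n) (a : R) (j : nat),
    [/\ 0 < a, (forall i, enorm (u i) < 1) &
    forall x U g, differentiable f x -> enorm (x - xb) < a ->
      (forall i, enorm (U i - u i) < a) -> min_norm_elt (sample_grads f x eps U) g ->
      nu < enorm g -> armijo_steps f beta gamma x g (gamma ^+ j)].
Proof.
move=> nm eps0 nu0 /andP[beta0 beta1] gamma01.
have [L L0 lip] := lipschitz_on_eball xb eps f_lip.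
pose G := nearby_grads xb eps.
have GL v : G v -> enorm v <= L.
  by move=> [y [Dy ye ->]]; apply: (grad_bound L0 lip) => //; exact: f_C1.1.
(* [C1] is the constant of [near_min_norm], [s * C2] will bound the squared distance from [g] to
   [p], and [q * C3] collects the losses in [descent]. *)
pose C1 := (1 + 4 * L ^+ 2) / 2.
pose C2 := 2 * L + 2 + 4 * L ^+ 2.
pose C3 := 2 * L + 1 + C1 + L * (C2 + 1).
have LL : 0 <= L ^+ 2 by rewrite exprn_ge0.
have C10 : 0 <= C1 by rewrite /C1; lra.
have C20 : 0 <= C2 by rewrite /C2; lra.
have C30 : 0 <= C3 by rewrite /C3 !addr_ge0 // mulr_ge0 // addr_ge0.
have num : 0 < (1 - beta) * nu ^+ 2 by rewrite mulr_gt0 ?exprn_gt0 // subr_gt0.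
pose q := Num.min 1 ((1 - beta) * nu ^+ 2 / (C3 + 1)).
have C31 : 0 < C3 + 1 by rewrite ltr_wpDl.
have q0 : 0 < q by rewrite lt_min ltr01 divr_gt0.
have q1 : q <= 1 by rewrite ge_min lexx.
have qC3 : q * C3 < (1 - beta) * nu ^+ 2.
  have : q <= (1 - beta) * nu ^+ 2 / (C3 + 1) by rewrite ge_min lexx orbT.
  by rewrite ler_pdivlMr // => h; lra.
(* With tolerance [s] on the gradients, [g - p] is only of the order of the square root of [s];
   taking [s] as a square makes that order [q], which was chosen to leave a positive margin after
   [q * C3]. *)
pose s := q ^+ 2.
have s0 : 0 < s by rewrite exprn_gt0.
have sq : s <= q by rewrite /s expr2 -[leRHS]mulr1 ler_pM2l.
have s01 : 0 < s <= 1 by rewrite s0 (le_trans sq).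
have [p Gp hp] := near_min_norm (nearby_grads_nonempty xb eps0) GL s01.
rewrite -/C1 in hp.
have pL : enorm p <= L := conv_enorm_le GL Gp.
have [v [l [Gv [l0 [l1 pE]]]]] := caratheodory nm Gp.
have [y hy] := choice Gv.
pose u i := eps^-1 *: (y i - xb).
have ua i : exists a : R, 0 < a /\ forall y' : 'rV[R]_n, enorm (y' - y i) < a ->
    [/\ D y', enorm (grad f y' - v i) < s & enorm (y' - xb) < eps].
  have [Dy ye ->] := hy i; have [a a0 ha] := continuous_grad_near Dy s0.
  exists (Num.min a (eps - enorm (y i - xb))); split; first by rewrite lt_min a0 subr_gt0.
  move=> y'; rewrite lt_min => /andP[/ha[Dy' gy'] h]; split => //.
  by rewrite -[y'](subrK (y i)) -addrA (le_lt_trans (enormD _ _)) // -ltrBrDr.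
have [a1 a1h] := choice ua => {ua}.
have eps1 : 0 < 1 + eps by rewrite addr_gt0.
have [a2 a20 ha2] : exists2 a2 : R, 0 < a2 & forall i, a2 <= a1 i.
  exists (\big[Num.min/1]_i a1 i).
    by elim/big_ind: _ => // [? ?|i _]; [rewrite lt_min => -> ->|have [] := a1h i].
  by move=> i; apply: bigmin_le_cond.
(* A sample is within [(1 + eps) * a] of [y i]. The bound [eps / 2] leaves room in the ball for a
   step shorter than [eps / 2], which the choice of [j] ensures. *)
pose a := Num.min (a2 / (1 + eps)) (eps / 2).
have [j hj] : exists j, gamma ^+ j < eps / 2 / (L + 1).
  by apply: small_power => //; rewrite !divr_gt0 // ltr_wpDl.
exists u, a, j; split.
- by rewrite lt_min !divr_gt0.
- move=> i; rewrite /u enormZ gtr0_norm ?invr_gt0 // mulrC ltr_pdivrMr // mul1r.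
  by have [] := hy i.
move=> x U g dx xa Ua [gconv gmin] nug.
have xeps2 : enorm (x - xb) < eps / 2.
  by apply: lt_le_trans xa _; rewrite ge_min lexx orbT.
have xeps : enorm (x - xb) < eps by lra.
have sample i : [/\ D (x + eps *: U i), enorm (grad f (x + eps *: U i) - v i) < s &
    enorm (x + eps *: U i - xb) < eps].
  have [_ h] := a1h i; apply: h.
  have -> : x + eps *: U i - y i = (x - xb) + eps *: (U i - u i).
    apply/rowP => k; rewrite /u !mxE mulrBr mulrA divff ?gt_eqF // mul1r; ring.
  have a2' : a <= a2 / (1 + eps) by rewrite ge_min lexx.
  rewrite (le_lt_trans (enormD _ _)) // enormZ gtr0_norm //.
  move: a2'; rewrite ler_pdivlMr // => a2'.
  have : eps * enorm (U i - u i) < eps * a by rewrite ltr_pM2l.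
  have := ha2 i; lra.
have gp : enorm g <= enorm p + s.
  pose p' := \sum_i l i *: grad f (x + eps *: U i).
  have /gmin : Defs.conv (sample_grads f x eps U) p'.
    exists m, (fun i => grad f (x + eps *: U i)), l; split => //.
    by move=> i; right; exists i.
  rewrite ler_pM2r ?invr_gt0 // ler_pXn2r ?nnegrE ?enorm_ge0 // => h.
  apply: le_trans h _; rewrite -[p'](subrK p) addrC (le_trans (enormD _ _)) // lerD2l.
  rewrite pE -sumrB (le_trans (enorm_sum _)) // -[leRHS]mul1r -l1 mulr_suml.
  apply: ler_sum => i _; rewrite -scalerBr enormZ ger0_norm // ler_wpM2l //.
  by have [_ /ltW] := sample i.
have gp2 : enorm g ^+ 2 <= enorm p ^+ 2 + s * (2 * L + 1).
  have : enorm g ^+ 2 <= (enorm p + s) ^+ 2.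
    by rewrite ler_pXn2r ?nnegrE ?addr_ge0 ?enorm_ge0 // ltW.
  have h1 : s * enorm p <= s * L by rewrite ler_pM2l.
  have h2 : s * s <= s * 1 by rewrite ler_pM2l // (le_trans sq).
  by move=> h; apply: le_trans h _; rewrite sqrrD; lra.
have gdot : enorm p ^+ 2 - s * C1 <= edot g p.
  apply: conv_edot_ge gconv => w [->|[i ->]].
    exact: nearby_grads_edot xeps dx hp.
  by apply: hp; have [? _ ?] := sample i; exists (x + eps *: U i).
have gpd : enorm (g - p) <= q * (C2 + 1).
  have q2 : 0 <= q * (C2 + 1) by rewrite mulr_ge0 ?(ltW q0) // addr_ge0.
  apply: enorm_lexi => //; apply: (@le_trans _ _ (s * C2)).
    rewrite edotDl !edotDr !edotNl !edotNr -!enorm_sqr (edotC p g).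
    move: gp2 gdot; rewrite /C2 /C1; lra.
  rewrite exprMn -/s ler_pM2l // expr2.
  have : 0 <= C2 * C2 by rewrite mulr_ge0.
  lra.
have descent w : G w -> beta * enorm g ^+ 2 + ((1 - beta) * nu ^+ 2 - q * C3) <= edot w g.
  move=> Gw; have h1 := hp w Gw.
  have h2 : - (L * (q * (C2 + 1))) <= edot w (g - p).
    rewrite lerNl -edotNl (le_trans (cauchy_schwarz _ _)) // enormN.
    by apply: ler_pM; rewrite ?enorm_ge0 // GL.
  have h3 : edot w g = edot w p + edot w (g - p) by rewrite edotDr edotNr subrKC.
  have h4 : (1 - beta) * nu ^+ 2 <= (1 - beta) * enorm g ^+ 2.
    by rewrite ler_pM2l ?subr_gt0 // ler_pXn2r ?nnegrE ?enorm_ge0 ?ltW.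
  have h5 : s * (2 * L + 1 + C1) <= q * (2 * L + 1 + C1).
    by rewrite ler_wpM2r // !addr_ge0 // mulr_ge0.
  rewrite h3 /C3; lra.
set t := gamma ^+ j.
have t0 : 0 < t by rewrite exprn_gt0 //; case/andP: gamma01.
have xt : enorm (x + - (t *: g) - xb) < eps.
  rewrite addrAC (le_lt_trans (enormD _ _)) // enormN enormZ gtr0_norm //.
  have gL : enorm g <= L + 1 by move: sq q1 gp pL; lra.
  have : t * enorm g <= t * (L + 1) by rewrite ler_pM2l.
  by move: hj; rewrite -/t ltr_pdivlMr ?ltr_wpDl // => hj; lra.
split; first by exists j.
pose z := (1 - beta) * nu ^+ 2 - q * C3.
have z0 : 0 < z by rewrite subr_gt0.
have : f (x + - (t *: g)) - f x <= - (t * (beta * enorm g ^+ 2 + z)).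
  apply: (mean_value xeps xt) => w Dw we.
  by rewrite edotNr edotZr lerN2 ler_pM2l // descent //; exists w.
have : 0 < t * z by rewrite mulr_gt0.
lra.
Qed.

End Armijo.

(** * Closedness of the Clarke subdifferential *)

Section ClarkeClosed.
Context {R : realType} {n : nat}.

Lemma ultra_fmap (T X : Type) (F : set_system T) (h : T -> X) :
  UltraFilter F -> UltraFilter (fmap h F).
Proof.
move=> FU; split; first exact: fmap_proper_filter.
move=> G GP hFG; apply/seteqP; split => [A GA|]; last exact: hFG.
have [//|FnA] := in_ultra_setVsetC (h @^-1` A) FU.
have GnA : G (~` A) by apply: hFG.
have := filterI GA GnA; rewrite setICr => G0.
by case: (@filter_not_empty _ _ GP (G0 _)).
Qed.

(** An ultrafilter finer than [eventually] makes all the sequences converge at once, where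
    subsequences would have to be extracted one after the other. *)
Lemma bounded_family_cluster (m : nat) (l : nat -> 'I_m -> R)
    (p : nat -> 'I_m -> 'rV[R]_n) (L : R) :
  (forall j i, 0 <= l j i <= 1) -> (forall j i, enorm (p j i) <= L) ->
  exists (lb : 'I_m -> R) (pb : 'I_m -> 'rV[R]_n), forall (e : R) (N : nat), 0 < e ->
    exists2 j, (N <= j)%N & forall i, `|l j i - lb i| < e /\ enorm (p j i - pb i) < e.
Proof.
move=> l01 pL.
have [F [FU FE]] := ultraFilterLemma (F := eventually) _.
have FF : Filter F by apply: filter_filter.
have lc i : exists a : R, fmap (l ^~ i) F --> a.
  have : compact (`[0, 1]%classic : set R) by exact: segment_compact.
  rewrite compact_ultra.
  move=> /(_ (fmap (l ^~ i) F) (ultra_fmap _ FU))[].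
    have : F setT by exact: filterT.
    by apply: (@filterS _ F FF) => j _ /=; rewrite in_itv /=; exact: l01.
  by move=> a [_ ha]; exists a.
have pc i : exists a : 'rV[R]_n, fmap (p ^~ i) F --> a.
  have := eball_compact (x := 0 : 'rV[R]_n) (r := L); rewrite compact_ultra.
  move=> /(_ (fmap (p ^~ i) F) (ultra_fmap _ FU))[].
    have : F setT by exact: filterT.
    apply: (@filterS _ F FF) => j _ /=.
    by rewrite /eball /= subr0.
  by move=> a [_ ha]; exists a.
have [lb hlb] := choice lc; have [pb hpb] := choice pc.
exists lb, pb => e N e0.
have H1 i : F [set j | `|l j i - lb i| < e].
  have /(_ _ (nbhsx_ballx _ _ e0)) := hlb i.
  by apply: (@filterS _ F FF) => j; rewrite /ball /= distrC.
have H2 i : F [set j | enorm (p j i - pb i) < e].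
  apply: (hpb i [set z | enorm (z - pb i) < e]).
  by apply/nbhs_enorm; exists e.
have H3 : F [set j | (N <= j)%N] by apply: FE; exists N.
have H4 : F [set j | forall i, `|l j i - lb i| < e /\ enorm (p j i - pb i) < e].
  by apply: filter_forall => i; apply: filterS (filterI (H1 i) (H2 i)).
have [j [Nj hj]] := @filter_ex _ _ (@ultra_proper _ _ FU) _ (filterI H3 H4).
by exists j.
Qed.

(** Caratheodory gives all approximating combinations the same length [n.+1], so weights and
    gradients can cluster jointly. Each limit [pb i] is a limiting gradient at [xb], along points
    chosen within [k.+1%:R^-1]. *)
Lemma clarke_closed (f : 'rV[R]_n -> R) (xb : 'rV[R]_n) : locally_lipschitz f ->
  (forall e : R, 0 < e -> exists2 g, enorm g <= e &
    Defs.conv [set v | exists y, [/\ differentiable f y, enorm (y - xb) <= e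
                              & v = grad f y]] g) ->
  clarke_stationary f xb.
Proof.
move=> lf approx.
have [L L0 lip] := lipschitz_on_eball xb 1 lf.
(* Starting at one half keeps all points strictly inside the unit ball, as [grad_bound] requires. *)
pose a (j : nat) : R := j.+2%:R^-1.
have a0 j : 0 < a j by rewrite invr_gt0.
have a1 j : a j < 1 by rewrite invf_lt1 // ltr1n.
have amono i j : (i <= j)%N -> a j <= a i by move=> ij; rewrite lef_pV2 ?posrE // ler_nat !ltnS.
have asmall e : 0 < e -> exists j, a j < e.
  move=> e0; exists (Num.truncn e^-1).
  rewrite /a invf_plt ?posrE // (lt_trans (truncnS_gt _)) // ltr_nat //.
have data j : exists z : ('I_n.+1 -> 'rV[R]_n) * ('I_n.+1 -> R),
    [/\ forall i, differentiable f (z.1 i) /\ enorm (z.1 i - xb) <= a j,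
        forall i, 0 <= z.2 i, \sum_i z.2 i = 1 &
        enorm (\sum_i z.2 i *: grad f (z.1 i)) <= a j].
  have [g ga] := approx _ (a0 j); move=> /(caratheodory (ltnSn n)).
  move=> [p [l [Sp [l0 [l1 gE]]]]]; have [y hy] := choice Sp.
  exists (y, l); split => //=.
    by move=> i; have [? ? _] := hy i.
  rewrite (_ : \sum_i _ = g) // gE; apply: eq_bigr => i _.
  by have [_ _ ->] := hy i.
have [z hz] := choice data.
pose l j i := (z j).2 i; pose y j i := (z j).1 i; pose p j i := grad f (y j i).
have l0 j i : 0 <= l j i by have [_ h _ _] := hz j; exact: h.
have l1 j : \sum_i l j i = 1 by have [_ _ h _] := hz j.
have l01 j i : 0 <= l j i <= 1.
  rewrite l0 -(l1 j) (bigD1 i) //= lerDl; exact: sumr_ge0.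
have pL j i : enorm (p j i) <= L.
  have [h _ _ _] := hz j; have [dy yx] := h i.
  by apply: (grad_bound L0 lip dy); apply: le_lt_trans yx (a1 j).
have [lb [pb near_b]] := bounded_family_cluster l01 pL.
have lb0 i : 0 <= lb i.
  apply/ler_addgt0Pr => e e0; have [j _ /(_ i)[h _]] := near_b e 0%N e0.
  by move: h; rewrite ltr_norml => /andP[_ h]; have := l0 j i; lra.
exists n.+1, pb, lb; split.
  move=> i.
  have yk (k : nat) : exists v, [/\ differentiable f v, enorm (v - xb) < k.+1%:R^-1 &
      enorm (grad f v - pb i) < k.+1%:R^-1].
    have k0 : (0 : R) < k.+1%:R^-1 by rewrite invr_gt0.
    have [j0 j0k] := asmall _ k0.
    have [j jj /(_ i)[_ h]] := near_b _ j0 k0; exists (y j i); split => //.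
      by have [+ _ _ _] := hz j => /(_ i)[].
    have [+ _ _ _] := hz j => /(_ i)[_ h']; apply: (le_lt_trans h').
    by apply: le_lt_trans j0k; exact: amono.
  have [v hv] := choice yk; exists v.
  have inv_small (e : R) : 0 < e -> \forall k \near \oo, k.+1%:R^-1 < e.
    move=> e0; exists (Num.truncn e^-1) => // k /= ek.
    rewrite invf_plt ?posrE // (lt_le_trans (truncnS_gt _)) // ler_nat ltnS //.
  split; last split.
  - apply/(cvg_enorm eventually_filter) => e /inv_small; apply: filterS => k.
    by apply: lt_trans; have [] := hv k.
  - by move=> k; have [] := hv k.
  - apply/(cvg_enorm eventually_filter) => e /inv_small; apply: filterS => k.
    by apply: lt_trans; have [] := hv k.
split => //; split.
  apply/eqP; rewrite -subr_eq0 -normr_le0; apply/ler_addgt0Pr => e e0; rewrite add0r.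
  have e1 : 0 < e / n.+1%:R by rewrite divr_gt0.
  have [j _ hj] := near_b _ 0%N e1.
  rewrite -(l1 j) -sumrB (le_trans (ler_norm_sum _ _ _)) //.
  apply: (@le_trans _ _ (\sum_(i < n.+1) e / n.+1%:R)).
    by apply: ler_sum => i _; rewrite distrC ltW //; have [] := hj i.
  by rewrite sumr_const card_ord -[leLHS]mulr_natl mulrC divfK.
have pbL i : enorm (pb i) <= L.
  apply/ler_addgt0Pr => e e0; have [j _ /(_ i)[_ h]] := near_b e 0%N e0.
  rewrite -[pb i](subrK (p j i)) addrC (le_trans (enormD _ _)) // lerD // enormB.
  exact: ltW.
suff small : enorm (\sum_i lb i *: pb i) <= 0.
  apply/esym/rowP => i; rewrite mxE; apply/eqP; rewrite -normr_le0.
  exact: le_trans (enorm_coord _ _) small.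
apply/ler_addgt0Pr => e e0; rewrite add0r.
(* The summand 1 accounts for the almost vanishing combination, and [L + 1] for the change of weight
   and gradient in each of the [n.+1] terms. *)
pose M := 1 + n.+1%:R * (L + 1).
have M0 : 0 < M by rewrite ltr_pwDl // mulr_ge0 // addr_ge0.
have e1 : 0 < e / M by rewrite divr_gt0.
have [N hN] := asmall _ e1; have [j jN hj] := near_b _ N e1.
have [_ _ _ hg] := hz j.
have -> : \sum_i lb i *: pb i = \sum_i l j i *: p j i + \sum_i (lb i *: pb i - l j i *: p j i).
  by rewrite -big_split; apply: eq_bigr => i _; rewrite /= subrKC.
apply: (le_trans (enormD _ _)); apply: (@le_trans _ _ (e / M + \sum_(i < n.+1) e / M * (L + 1))).
  apply: lerD; first by apply: (le_trans hg); rewrite (le_trans (amono _ _ jN)) // ltW.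
  apply: (le_trans (enorm_sum _)); apply: ler_sum => i _; have [hl hp] := hj i.
  have -> : lb i *: pb i - l j i *: p j i =
      (lb i - l j i) *: pb i + l j i *: (pb i - p j i).
    by apply/rowP => k; rewrite !mxE; ring.
  rewrite (le_trans (enormD _ _)) // !enormZ mulrDr mulr1 lerD //.
    by rewrite ler_pM ?enorm_ge0 // distrC ltW.
  have /andP[h0 h1] := l01 j i; rewrite ger0_norm // enormB.
  rewrite -[leRHS]mul1r ler_pM ?enorm_ge0 //; exact: ltW.
rewrite sumr_const card_ord -[X in _ + X]mulr_natl.
have -> : e / M + n.+1%:R * (e / M * (L + 1)) = e / M * M by rewrite /M; ring.
by rewrite divfK // gt_eqF.
Qed.

End ClarkeClosed.

(** * Almost sure properties of the samples *)

Section Trials.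
Context {R : realType} {d : measure_display} {Omega : measurableType d}.
Variable P : probability Omega R.
Local Open Scope ereal_scope.

Lemma ae_forall_countable (I : countType) (Q : I -> Omega -> Prop) :
  (forall i, P.-negligible [set w | ~ Q i w]) ->
  P.-negligible [set w | ~ forall i, Q i w].
Proof.
move=> nQ.
pose B (k : nat) : set Omega := if (unpickle k : option I) is Some i
  then [set w | ~ Q i w] else set0.
apply: (@negligibleS _ _ _ _ (\bigcup_k B k)).
  move=> w /existsNP[i nQi]; exists (pickle i) => //.
  by rewrite /B pickleK.
apply: negligible_bigcup => k; rewrite /B; case: unpickle => // .
exact: negligible_set0.
Qed.

(** Given the past, each trial fails with probability [1 - p], so [N] failures in a row have
    probability [(1 - p) ^+ N]. This is the second Borel-Cantelli argument for adapted events. *)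
Lemma independent_trials (F : nat -> set (set Omega)) (H : nat -> set Omega) (p : R) :
  (0 < p)%R -> (forall k, sigma_algebra setT (F k)) ->
  (forall k A, F k A -> measurable A) -> (forall k, measurable (H k)) ->
  (forall j k, (j < k)%N -> F k (H j)) ->
  (forall k A, F k A -> P (A `&` H k) = P A * p%:E) ->
  forall k0, P.-negligible [set w | forall k, (k0 <= k)%N -> ~ H k w].
Proof.
move=> p0 sF mF mH FH ind k0.
pose A N := \bigcap_(k in [set k | (k < N)%N]) ~` H (k0 + k)%N.
have FA N : F (k0 + N)%N (A N).
  have [F0 FC FU] := sF (k0 + N)%N.
  rewrite -[A N]setCK -setTD; apply: (FC); rewrite /A setC_bigcap.
  rewrite bigcup_mkcond; apply: (FU) => k; case: ifPn => [|_]; last exact: F0.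
  by rewrite inE /= setCK => kN; apply: FH; rewrite ltn_add2l.
have AS N : A N.+1 = A N `\` H (k0 + N)%N.
  apply/seteqP; split => [w hw|w [hw nH] k /=].
    by split; [move=> k /= kN; apply: hw; rewrite /= ltnW|exact: (hw N (ltnSn N))].
  by rewrite ltnS leq_eqVlt => /orP[/eqP ->|/hw].
have p1 : (p <= 1)%R.
  have := ind 0%N setT; have [F0 FC _] := sF 0%N.
  have FT : F 0%N setT by rewrite -(setD0 setT); exact: FC.
  move=> /(_ FT); rewrite setTI [X in X * _]probability_setT mul1e => h.
  by rewrite -lee_fin -h probability_le1.
have PA N : P (A N) = ((1 - p) ^+ N)%:E.
  elim: N => [|N IH].
    rewrite expr0 /A (_ : \bigcap_(_ in _) _ = setT) ?probability_setT //.
    by apply/seteqP; split.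
  rewrite AS measureD //; last 2 first.
  - exact: mF (FA N).
  - by apply: (le_lt_trans (probability_le1 _ (mF _ _ (FA N)))); rewrite ltry.
  rewrite [X in _ - X]ind //.
  by rewrite [X in X - X * _]IH -EFinM -EFinB exprSr mulrBr mulr1.
apply: (@negligibleS _ _ _ _ (\bigcap_N A N)).
  by move=> w hw N _ k _; apply: hw; exact: leq_addr.
have mA : measurable (\bigcap_N A N).
  by apply: bigcapT_measurable => N; exact: mF (FA N).
apply/negligibleP => //; apply/eqP; rewrite -measure_le0.
apply/lee_addgt0Pr => e e0; rewrite add0e.
have : (fun N => (1 - p) ^+ N)%R @ \oo --> (0 : R)%R.
  by apply: cvg_expr; rewrite ger0_norm ?subr_ge0 // gtrBl.
move=> /cvgrPdist_lt/(_ e e0)[N _ /(_ N (leqnn N))].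
rewrite sub0r normrN ger0_norm ?exprn_ge0 ?subr_ge0 // => he.
apply: (@le_trans _ _ (P (A N))); last by rewrite PA lee_fin ltW.
apply: le_measure; rewrite ?inE //; first exact: mF (FA N).
by move=> w /(_ N I).
Qed.

End Trials.

Section Sampling.
Context {R : realType} {n m : nat} {d : measure_display} {Omega : measurableType d}.
Variables (P : probability Omega R) (U : nat -> 'I_m -> Omega -> 'rV[R]_n).
Variables (X : nat -> Omega -> 'rV[R]_n) (G : nat -> set (set Omega)).
Local Open Scope ereal_scope.
Hypothesis n_gt0 : (0 < n)%N.
Hypothesis U_meas : forall k i a b, measurable (U k i @^-1` obox a b).
Hypothesis U_unif : forall k i a b,
  P (U k i @^-1` obox a b) * leb_outer (eball (0 : 'rV[R]_n) 1)
  = leb_outer (obox a b `&` eball 0 1).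
Hypothesis G_meas : forall k A, G k A -> measurable A.
Hypothesis G_X : forall k a b, G k (X k @^-1` obox a b).
Hypothesis G_U : forall j k i a b, (j < k)%N -> G k (U j i @^-1` obox a b).
Hypothesis U_indep : forall k A (a b : 'I_m -> 'rV[R]_n), <<s G k >> A ->
  P (A `&` [set w | forall i, obox (a i) (b i) (U k i w)])
  = P A * \prod_(i < m) P (U k i @^-1` obox (a i) (b i)).

Lemma history_measurable k A : <<s G k >> A -> measurable A.
Proof.
apply: smallest_sub; last exact: G_meas.
exact: sigma_algebra_measurable.
Qed.

(** The sigma-algebra is arbitrary because [boxes_hit_io] needs the measurable sets as well as a
    later history. *)
Lemma joint_box (F : set (set Omega)) k (a b : 'I_m -> 'rV[R]_n) :
  sigma_algebra setT F -> (forall i a b, F (U k i @^-1` obox a b)) ->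
  F [set w | forall i, obox (a i) (b i) (U k i w)].
Proof.
move=> [F0 FC FU] FUk.
rewrite -[X in F X]setCK -setTD; apply: (FC).
pose B (j : nat) : set Omega := if (unpickle j : option 'I_m) is Some i
  then ~` (U k i @^-1` obox (a i) (b i)) else set0.
rewrite (_ : ~` _ = \bigcup_j B j).
  apply: (FU) => j; rewrite /B; case: unpickle => [i|]; last exact: F0.
  by rewrite -setTD; apply: (FC).
apply/seteqP; split => [w /= /existsNP[i hi]|w [j _]].
  by exists (pickle i) => //; rewrite /B pickleK.
by rewrite /B; case: unpickle => // i /= hi h; apply: hi.
Qed.

Lemma bounded_negligible k i :
  P.-negligible [set w | ~ obox (const_mx (-2)%R) (const_mx 2%R) (U k i w)].
Proof.
apply/negligibleP; first exact: measurableC (U_meas k i _ _).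
have h := unit_uniform_bounded n_gt0 (U_meas k i) (U_unif k i).
have := probability_setC P (U_meas k i (const_mx (-2)%R) (const_mx 2%R)).
by rewrite [X in _ - X]h subee.
Qed.

(** The radius [e] is deterministic; the random radius is recovered from the countably many values
    it can take. *)
Lemma sample_negligible k i (N : set 'rV[R]_n) (e : R) : leb_null N -> (0 < e)%R ->
  P.-negligible [set w | N (X k w + e *: U k i w)%R].
Proof.
move=> N0 e0.
(* Independence from the past is given for the whole tuple of samples, so the other samples are put
   into boxes of probability 1; [B] becomes the event [G] of [smeared_null]. *)
pose B := [set w | forall i', i' != i -> obox (const_mx (-2)%R) (const_mx 2%R) (U k i' w)].
have mB : measurable B.
  have -> : B = \bigcap_(i' in [set i' | i' != i])
      U k i' @^-1` obox (const_mx (-2)%R) (const_mx 2%R).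
    by apply/seteqP; split => w h i'; exact: h.
  by apply: fin_bigcap_measurable => [|i' _]; [exact: finite_finset|exact: U_meas].
have [K K0 hK] := unit_uniform_le n_gt0 (U_unif k i).
have GX a b : <<s G k >> (X k @^-1` hbox a b).
  by apply: sigma_algebra_hbox => a' b'; apply: sub_gen_smallest.
have mX a b : measurable (X k @^-1` hbox a b) by exact: history_measurable.
apply: (@negligibleS _ _ _ _ ((B `&` [set w | N (X k w + e *: U k i w)%R]) `|`
    [set w | ~ forall i', obox (const_mx (-2)%R) (const_mx 2%R) (U k i' w)])).
  move=> w Nw.
  have [h|h] := pselect (forall i', obox (const_mx (-2)%R) (const_mx 2%R) (U k i' w)).
    by left; split => // i' _.
  by right.
apply: negligibleU; last by apply: ae_forall_countable => i'; exact: bounded_negligible.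
apply: (@smeared_null _ _ _ _ P B (X k) (U k i) K e) => //.
move=> a b a' b'.
pose a2 i' := if i' == i then a' else const_mx (-2)%R : 'rV[R]_n.
pose b2 i' := if i' == i then b' else const_mx 2%R : 'rV[R]_n.
have -> : B `&` U k i @^-1` obox a' b' =
    [set w | forall i', obox (a2 i') (b2 i') (U k i' w)].
  apply/seteqP; split => [w [Bw hw] i'|w h].
    by rewrite /a2 /b2; case: (eqVneq i' i) => [->|/Bw].
  split; last by have := h i; rewrite /a2 /b2 eqxx.
  by move=> i' ii'; have := h i'; rewrite /a2 /b2 (negbTE ii').
rewrite U_indep // lee_wpmul2l // (bigD1 i) //= [X in _ * X]big1 ?mule1.
  by rewrite /a2 /b2 eqxx.
by move=> i' ii'; rewrite /a2 /b2 (negbTE ii') (unit_uniform_bounded n_gt0 (U_meas k i') (U_unif k i')).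
Qed.

(** A constant centre makes the independence condition trivial. The mollification needs this case,
    its centres being deterministic. *)
Lemma fixed_center_negligible k i (N : set 'rV[R]_n) (z : 'rV[R]_n) (e : R) :
  leb_null N -> (0 < e)%R -> P.-negligible [set w | N (z + e *: U k i w)%R].
Proof.
move=> N0 e0; have [K K0 hK] := unit_uniform_le n_gt0 (U_unif k i).
rewrite -[X in _.-negligible X]setTI.
apply: (@smeared_null _ _ _ _ P setT (fun=> z) (U k i) K e) => //.
  move=> a b; have [zab|nz] := pselect (hbox a b z).
    by rewrite (_ : _ @^-1` _ = setT) //; apply/seteqP; split.
  by rewrite (_ : _ @^-1` _ = set0) //; apply/seteqP; split.
move=> a b a' b'; rewrite setTI.
have [zab|nz] := pselect (hbox a b z).
  rewrite (_ : _ @^-1` _ = setT); last by apply/seteqP; split.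
  by rewrite setTI [X in _ <= X * _]probability_setT mul1e.
rewrite (_ : _ @^-1` _ = set0) ?set0I ?measure0 ?mul0e //.
by apply/seteqP; split.
Qed.

Lemma boxes_hit_io (a b u : 'I_m -> 'rV[R]_n) k0 :
  (forall i, obox (a i) (b i) (u i)) -> (forall i, enorm (u i) < 1)%R ->
  P.-negligible [set w | forall k, (k0 <= k)%N ->
    ~ forall i, obox (a i) (b i) (U k i w)].
Proof.
move=> uab u1; have [v v0 Vv] := @unit_ball_volume R n n_gt0.
(* Dividing [U_unif] by the volume [v] shows that the law does not change with [k], so all rounds
   have the same success probability [p]. *)
have same k i : P (U k i @^-1` obox (a i) (b i)) = P (U 0 i @^-1` obox (a i) (b i)).
  have := U_unif k i (a i) (b i); rewrite -(U_unif 0 i) Vv.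
  move=> /(congr1 (fun y => y * (v^-1)%:E)).
  by rewrite -!muleA -EFinM divff ?gt_eqF // !mule1.
pose p := (\prod_i fine (P (U 0 i @^-1` obox (a i) (b i))))%R.
have pE k : \prod_i P (U k i @^-1` obox (a i) (b i)) = p%:E.
  rewrite /p -prodEFin; apply: eq_bigr => i _; rewrite same fineK //.
  exact: fin_num_measure.
apply: (@independent_trials _ _ _ P (fun k => <<s G k >>)
  (fun k => [set w | forall i, obox (a i) (b i) (U k i w)]) p).
- apply: prodr_gt0 => i _; apply: fine_gt0.
  rewrite (unit_uniform_gt0 n_gt0 (U_unif 0 i) (uab i) (u1 i)) /=.
  by rewrite (le_lt_trans (probability_le1 P (U_meas 0 i (a i) (b i)))) // ltry.
- by move=> k; exact: smallest_sigma_algebra.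
- by move=> k A; exact: history_measurable.
- by move=> k; apply: joint_box => //; exact: sigma_algebra_measurable.
- move=> j k jk; apply: joint_box; first exact: smallest_sigma_algebra.
  by move=> i a' b'; apply: sub_gen_smallest; exact: G_U.
- by move=> k A GA; rewrite U_indep // pE.
Qed.

End Sampling.

(** * Runs of the algorithm *)

Section Run.
Context {R : realType} {n m : nat}.
Variables (f : 'rV[R]_n -> R) (D : set 'rV[R]_n).
Hypotheses (f_lip : locally_lipschitz f) (D_open : open D) (f_C1 : C1_on f D).
Hypothesis mean_value : forall (xb x h : 'rV[R]_n) (r c : R),
  enorm (x - xb) < r -> enorm (x + h - xb) < r ->
  (forall y, D y -> enorm (y - xb) < r -> edot (grad f y) h <= c) ->
  f (x + h) - f x <= c.
Variables (eps0 nu0 beta gamma theta_nu theta_eps : R).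
Hypotheses (eps0_gt0 : 0 < eps0) (nu0_gt0 : 0 < nu0) (m_ge : (n.+1 <= m)%N)
  (beta01 : 0 < beta < 1) (gamma01 : 0 < gamma < 1)
  (theta_nu01 : 0 < theta_nu < 1) (theta_eps01 : 0 < theta_eps < 1).
Variables (x : nat -> 'rV[R]_n) (U : nat -> 'I_m -> 'rV[R]_n)
  (g : nat -> 'rV[R]_n) (eps nu t : nat -> R).

Definition well_defined_at k :=
  differentiable f (x k) /\ forall i, differentiable f (x k + eps k *: U k i).

Hypotheses (x0_diff : differentiable f (x 0)) (eps_init : eps 0 = eps0)
  (nu_init : nu 0 = nu0).
Hypothesis step2 : forall k, well_defined_at k ->
  min_norm_elt (sample_grads f (x k) (eps k) (U k)) (g k).
Hypothesis step4 : forall k, well_defined_at k -> ~ gs_terminates (g k) (eps k) ->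
  (enorm (g k) <= nu k ->
     nu k.+1 = theta_nu * nu k /\ eps k.+1 = theta_eps * eps k /\ t k = 0) /\
  (nu k < enorm (g k) ->
     nu k.+1 = nu k /\ eps k.+1 = eps k /\
     armijo_steps f beta gamma (x k) (g k) (t k) /\
     (forall s, armijo_steps f beta gamma (x k) (g k) s -> s <= t k)).
Hypothesis step5 : forall k, well_defined_at k -> ~ gs_terminates (g k) (eps k) ->
  (differentiable f (x k - t k *: g k) -> x k.+1 = x k - t k *: g k) /\
  (~ differentiable f (x k - t k *: g k) ->
     differentiable f (x k.+1) /\
     f (x k.+1) < f (x k) - beta * t k * enorm (g k) ^+ 2 /\
     enorm (x k - t k *: g k - x k.+1) <= Num.min (t k) (eps k) * enorm (g k)).
Hypothesis sample_in_D : forall k i j, D (x k + (theta_eps ^+ j * eps0) *: U k i).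
Variable M : R.
Hypothesis U_bounded : forall k i, enorm (U k i) <= M.
Hypothesis hit_io : forall (u : 'I_m -> 'rV[R]_n) (a : R) k0, 0 < a ->
  (forall i, enorm (u i) < 1) ->
  exists2 k, (k0 <= k)%N & forall i, enorm (U k i - u i) < a.

(** Both [eps k] and [nu k] are functions of this count: it gives their limits as well as the
    countable range of the radii. *)
Definition reductions (k : nat) : nat := (\sum_(j < k) (enorm (g j) <= nu j)%R)%N.

Lemma reductionsS k : reductions k.+1 = (reductions k + (enorm (g k) <= nu k)%R)%N.
Proof. by rewrite /reductions big_ord_recr. Qed.

Lemma reductions_mono j k : (j <= k)%N -> (reductions j <= reductions k)%N.
Proof.
move=> /subnKC <-; elim: (k - j)%N => [|i IH]; first by rewrite addn0.
by rewrite addnS reductionsS (leq_trans IH) // leq_addr.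
Qed.

(** The steps are assumed only where the gradients exist, so each induction step must first
    establish [well_defined_at k]; the explicit form of the radius is what makes [sample_in_D]
    applicable. *)
Lemma run_invariant k : [/\ differentiable f (x k), eps k = theta_eps ^+ reductions k * eps0 &
  nu k = theta_nu ^+ reductions k * nu0].
Proof.
have [te0 _] := andP theta_eps01.
elim: k => [|k [dx ek nk]]; first by rewrite /reductions big_ord0 !expr0 !mul1r.
have ek0 : 0 < eps k by rewrite ek mulr_gt0 ?exprn_gt0.
have wd : well_defined_at k.
  by split => // i; rewrite ek; exact: f_C1.1.
have nt : ~ gs_terminates (g k) (eps k) by move=> [_]; rewrite leNgt ek0.
have [red_step no_red] := step4 wd nt.
have [dstep ndstep] := step5 wd nt.
split.
- by have [h|h] := pselect (differentiable f (x k - t k *: g k));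
    [rewrite dstep|have [] := ndstep h].
- rewrite reductionsS; case: (leP (enorm (g k)) (nu k)) => h.
    by have [_ [-> _]] := red_step h; rewrite addn1 exprS ek mulrA.
  by have [_ [-> _]] := no_red h; rewrite addn0 ek.
- rewrite reductionsS; case: (leP (enorm (g k)) (nu k)) => h.
    by have [-> _] := red_step h; rewrite addn1 exprS nk mulrA.
  by have [-> _] := no_red h; rewrite addn0 nk.
Qed.

Lemma run_eps_gt0 k : 0 < eps k.
Proof.
have [te0 _] := andP theta_eps01.
by have [_ -> _] := run_invariant k; rewrite mulr_gt0 ?exprn_gt0.
Qed.

Lemma run_nu_gt0 k : 0 < nu k.
Proof.
have [te0 _] := andP theta_nu01.
by have [_ _ ->] := run_invariant k; rewrite mulr_gt0 ?exprn_gt0.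
Qed.

Lemma run_well_defined k : well_defined_at k.
Proof.
have [dx ek _] := run_invariant k; split => // i; rewrite ek; exact: f_C1.1.
Qed.

Lemma run_continues k : ~ gs_terminates (g k) (eps k).
Proof. by move=> [_]; rewrite leNgt run_eps_gt0. Qed.

Lemma run_step_ge0 k : 0 <= t k.
Proof.
have [red_step no_red] := step4 (run_well_defined k) (@run_continues k).
case: (leP (enorm (g k)) (nu k)) => h; first by have [_ [_ ->]] := red_step h.
have [_ [_ [[[j ->] _] _]]] := no_red h.
by rewrite exprn_ge0 // ltW //; case/andP: gamma01.
Qed.

#[local] Hint Resolve run_eps_gt0 run_nu_gt0 run_step_ge0 : core.

Lemma run_decrease k : f (x k.+1) <= f (x k) - beta * t k * enorm (g k) ^+ 2.
Proof.
have [red_step no_red] := step4 (run_well_defined k) (@run_continues k).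
have [dstep ndstep] := step5 (run_well_defined k) (@run_continues k).
case: (pselect (differentiable f (x k - t k *: g k))) => h; last first.
  by have [_ [/ltW]] := ndstep h.
rewrite dstep //; case: (leP (enorm (g k)) (nu k)) => hg.
  by have [_ [_ ->]] := red_step hg; rewrite scale0r !(subr0, mulr0, mul0r).
by have [_ [_ [[_ /ltW]]]] := no_red hg.
Qed.

(** The factor 2 allows for the perturbation in Step 5, which is at most as long as the step
    itself. *)
Lemma run_step_length k : enorm (x k.+1 - x k) <= 2 * t k * enorm (g k).
Proof.
have [dstep ndstep] := step5 (run_well_defined k) (@run_continues k).
have tg : 0 <= t k * enorm (g k) by rewrite mulr_ge0 ?enorm_ge0.
case: (pselect (differentiable f (x k - t k *: g k))) => h.
  rewrite dstep // addrAC subrr add0r enormN enormZ ger0_norm //; lra.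
have [_ [_ hn]] := ndstep h.
have -> : x k.+1 - x k = - (x k - t k *: g k - x k.+1) - t k *: g k.
  by apply/rowP => i; rewrite !mxE; ring.
rewrite (le_trans (enormD _ _)) // !enormN enormZ ger0_norm //.
have : Num.min (t k) (eps k) * enorm (g k) <= t k * enorm (g k).
  by rewrite ler_wpM2r ?enorm_ge0 // ge_min lexx.
lra.
Qed.

Lemma run_nonincreasing k : f (x k.+1) <= f (x k).
Proof.
apply: (le_trans (run_decrease k)); rewrite gerBl.
by rewrite !mulr_ge0 ?exprn_ge0 ?enorm_ge0 //; case/andP: beta01 => /ltW.
Qed.

Lemma run_value_mono j k : (j <= k)%N -> f (x k) <= f (x j).
Proof.
move=> /subnKC <-; elim: (k - j)%N => [|i IH]; first by rewrite addn0.
by rewrite addnS (le_trans (run_nonincreasing _)).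
Qed.

(** Distance is paid for by decrease: a move of length at most [2 * t k * enorm (g k)] lowers [f] by
    at least [beta * t k * enorm (g k) ^+ 2]. *)
Lemma run_travel k c : 0 < c -> c <= enorm (g k) ->
  enorm (x k.+1 - x k) <= 2 / (beta * c) * (f (x k) - f (x k.+1)).
Proof.
move=> c0 cg; have [b0 _] := andP beta01.
rewrite mulrAC ler_pdivlMr ?mulr_gt0 //.
have h1 := run_decrease k.
have h2 : enorm (x k.+1 - x k) * (beta * c) <= 2 * t k * enorm (g k) * (beta * enorm (g k)).
  apply: ler_pM; rewrite ?enorm_ge0 ?mulr_ge0 ?(ltW b0) ?(ltW c0) ?run_step_length //.
  by rewrite ler_pM2l.
by apply: (le_trans h2); move: h1; rewrite expr2; lra.
Qed.

Lemma run_travel_between c k j : 0 < c -> (k <= j)%N ->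
  (forall i, (k <= i < j)%N -> c <= enorm (g i)) ->
  enorm (x j - x k) <= 2 / (beta * c) * (f (x k) - f (x j)).
Proof.
move=> c0 /subnKC <-; elim: (j - k)%N => [|i IH] hg.
  by rewrite addn0 !subrr enorm0 mulr0.
have h1 : enorm (x (k + i) - x k) <= 2 / (beta * c) * (f (x k) - f (x (k + i))).
  apply: IH => i' /andP[h3 h4]; apply: hg; rewrite h3 addnS ltnS ltnW //.
have h2 : enorm (x (k + i).+1 - x (k + i)) <=
    2 / (beta * c) * (f (x (k + i)) - f (x (k + i).+1)).
  by apply: run_travel => //; apply: hg; rewrite leq_addr addnS ltnSn.
rewrite addnS; move: h1 h2 (enormD (x (k + i).+1 - x (k + i)) (x (k + i) - x k)).
by rewrite addrA subrK; move: (2 / _) => C; lra.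
Qed.

(** * Runs whose values stay bounded below *)

Hypothesis f_bounded : exists lb, forall k, lb <= f (x k).

Lemma run_value_cauchy e : 0 < e -> exists N, forall k j, (N <= k)%N -> f (x k) - f (x j) < e.
Proof.
move=> e0; have [lb hlb] := f_bounded.
pose A := range (fun k => f (x k)).
have lbA : has_lbound A by exists lb => _ [k _ <-].
have infA : has_inf A by split => //; exists (f (x 0)), 0%N.
have [_ [N _ <-] hN] := inf_adherent e0 infA.
exists N => k j Nk; have := run_value_mono Nk.
have : inf A <= f (x j) by apply: ge_inf => //; exists j.
lra.
Qed.

Lemma reductions_unbounded N : exists k, (N <= reductions k)%N.
Proof.
apply: contrapT => none.
have [K hK] : exists K, forall k, (K <= k)%N -> reductions k = reductions K.
  have redN k : (reductions k < N)%N.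
    by rewrite ltnNge; apply/negP => h; apply: none; exists k.
  have [K hK] : exists K, forall k, (reductions k <= reductions K)%N.
    have ex : exists r, `[< exists K, reductions K = r >] by exists (reductions 0); apply/asboolP; exists 0%N.
    have ub r : `[< exists K, reductions K = r >] -> (r <= N)%N.
      by move=> /asboolP[K <-]; exact: ltnW.
    case: (ex_maxnP ex ub) => r /asboolP[K rK] hr; exists K => k.
    by rewrite rK; apply: hr; apply/asboolP; exists k.
  by exists K => k Kk; apply/eqP; rewrite eqn_leq hK reductions_mono.
have large k : (K <= k)%N -> nu k < enorm (g k).
  move=> Kk; have := reductionsS k; rewrite hK ?(leqW Kk) // (hK k) //.
  by case: (leP (enorm (g k)) (nu k)) => // _ /eqP; rewrite addn1 -[X in X == _]addn0 -addn1 eqn_add2l.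
have nuK k : (K <= k)%N -> nu k = nu K.
  move=> Kk; have [_ _ ->] := run_invariant k.
  by have [_ _ ->] := run_invariant K; rewrite hK.
have epsK k : (K <= k)%N -> eps k = eps K.
  move=> Kk; have [_ -> _] := run_invariant k.
  by have [_ -> _] := run_invariant K; rewrite hK.
have nu_g k : (K <= k)%N -> nu K <= enorm (g k).
  by move=> Kk; rewrite -(nuK k Kk) ltW // large.
have [b0 b1] := andP beta01.
have travel k j : (K <= k)%N -> (k <= j)%N ->
    enorm (x j - x k) <= 2 / (beta * nu K) * (f (x k) - f (x j)).
  move=> Kk kj; apply: run_travel_between => // i /andP[ki _].
  by apply: nu_g; exact: leq_trans ki.
have C0 : 0 < 2 / (beta * nu K) by rewrite divr_gt0 ?mulr_gt0.
have cauchy e : 0 < e -> exists N', (K <= N')%N /\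
    forall k j, (N' <= k)%N -> (N' <= j)%N -> enorm (x j - x k) < e.
  move=> e0; have [N' hN'] := run_value_cauchy (divr_gt0 e0 C0).
  exists (maxn K N'); split; first exact: leq_maxl.
  have main k j : (maxn K N' <= k)%N -> (k <= j)%N -> enorm (x j - x k) < e.
    rewrite geq_max => /andP[Kk Nk] kj; apply: (le_lt_trans (travel _ _ Kk kj)).
    by rewrite mulrC -ltr_pdivlMr //; exact: hN'.
  move=> k j hk hj; have [kj|jk] := leqP k j; first exact: main.
  by rewrite enormB; apply: main => //; exact: ltnW.
have [xb hxb] : exists xb, forall e, 0 < e -> exists N', forall k, (N' <= k)%N ->
    enorm (x k - xb) < e.
  have [N1 [_ h1]] := cauchy 1 ltr01.
  (* A family of one vector, with dummy weight 0, yields a cluster point, and the Cauchy property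
     turns it into the limit. *)
  pose p (j : nat) (i : 'I_1) := x (N1 + j).
  have pL j i : enorm (p j i) <= enorm (x N1) + 1.
    rewrite /p -[x (N1 + j)](subrK (x N1)) addrC (le_trans (enormD _ _)) // lerD2l.
    by apply: ltW; apply: h1 => //; exact: leq_addr.
  pose z (_ : nat) (_ : 'I_1) : R := 0.
  have z01 j i : 0 <= z j i <= 1 by rewrite /z lexx ler01.
  have [zb [pb hpb]] := bounded_family_cluster z01 pL.
  exists (pb ord0) => e e0; have e2 : 0 < e / 2 by rewrite divr_gt0.
  have [N2 [_ h2]] := cauchy _ e2; exists N2 => k N2k.
  have [j N2j /(_ ord0)[_ hj]] := hpb _ N2 e2.
  have := h2 (N1 + j)%N k (leq_trans N2j (leq_addl _ _)) N2k.
  have := enormD (x k - x (N1 + j)) (x (N1 + j) - pb ord0).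
  by rewrite addrA subrK; move: hj; rewrite /p; lra.
have [u [a [j [a0 u1 good]]]] := good_samples f_lip D_open f_C1 mean_value xb m_ge
  (run_eps_gt0 K) (run_nu_gt0 K) beta01 gamma01.
have [N1 hN1] := hxb a a0.
have gj0 : 0 < gamma ^+ j by rewrite exprn_gt0 //; case/andP: gamma01.
(* A step of size at least [gamma ^+ j] along a direction of norm at least [nu K] lowers [f] by this
   amount, which is more than the values can still fall after [N2]. *)
have drop0 : 0 < beta * gamma ^+ j * nu K ^+ 2.
  by rewrite !mulr_gt0 // exprn_gt0.
have [N2 hN2] := run_value_cauchy drop0.
have [k hk Uk] := hit_io (maxn K (maxn N1 N2)) a0 u1.
move: hk; rewrite !geq_max => /and3P[Kk N1k N2k].
have [_ no_red] := step4 (run_well_defined k) (@run_continues k).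
have [_ [_ [_ tmax]]] := no_red (large k Kk).
have := tmax (gamma ^+ j); have [dx _] := run_well_defined k.
have hmin := step2 (run_well_defined k).
have := good (x k) (U k) (g k) dx (hN1 k N1k) Uk.
rewrite -(epsK k Kk) -(nuK k Kk) => /(_ hmin (large k Kk)) hA /(_ hA) tj.
have := hN2 k k.+1 N2k; have := run_decrease k.
have : beta * gamma ^+ j * nu K ^+ 2 <= beta * t k * enorm (g k) ^+ 2.
  apply: ler_pM; rewrite ?exprn_ge0 ?mulr_ge0 ?(ltW b0) ?(ltW gj0) ?(ltW (run_nu_gt0 K)) //.
    by rewrite ler_pM2l.
  by rewrite ler_pXn2r ?nnegrE ?enorm_ge0 ?(ltW (run_nu_gt0 K)) // nu_g.
lra.
Qed.

Lemma reduced_vanishes (th c : R) : 0 < th < 1 -> 0 < c ->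
  forall e, 0 < e -> exists N, forall k, (N <= k)%N -> th ^+ reductions k * c < e.
Proof.
move=> th01 c0 e e0; have [th0 th1] := andP th01.
have [j hj] := small_power th01 (divr_gt0 e0 c0).
have [N hN] := reductions_unbounded j; exists N => k Nk.
rewrite -ltr_pdivlMr //; apply: le_lt_trans hj.
by rewrite ler_wiXn2l ?(ltW th0) ?(ltW th1) // (leq_trans hN) // reductions_mono.
Qed.

Lemma run_eps_small e : 0 < e -> exists N, forall k, (N <= k)%N -> eps k < e.
Proof.
move=> e0; have [N hN] := reduced_vanishes theta_eps01 eps0_gt0 e0.
by exists N => k /hN; have [_ <- _] := run_invariant k.
Qed.

Lemma run_nu_small e : 0 < e -> exists N, forall k, (N <= k)%N -> nu k < e.
Proof.
move=> e0; have [N hN] := reduced_vanishes theta_nu01 nu0_gt0 e0.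
by exists N => k /hN; have [_ _ <-] := run_invariant k.
Qed.

(* Once [f] has almost reached its infimum, a run whose steps near [xb] all have
   length at least [c] is trapped near [xb], so the target [nu] would never be
   reduced again. *)
Lemma run_small_gradient_near xb c N : 0 < c ->
  (forall e N', 0 < e -> exists2 k, (N' <= k)%N & enorm (x k - xb) < e) ->
  exists k, [/\ (N <= k)%N, enorm (x k - xb) <= c & enorm (g k) <= c].
Proof.
move=> c0 near_xb; apply: contrapT => none.
have big k : (N <= k)%N -> enorm (x k - xb) <= c -> c < enorm (g k).
  by move=> Nk xk; rewrite ltNge; apply/negP => gk; apply: none; exists k.
have [b0 _] := andP beta01.
have C0 : 0 < 2 / (beta * c) by rewrite divr_gt0 ?mulr_gt0.
have c2 : 0 < c / 2 by rewrite divr_gt0.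
(* After [N1] the values can fall so little that [run_travel_between] allows only displacements
   below [c / 2]. *)
have [N1 hN1] := run_value_cauchy (divr_gt0 c2 C0).
have [k] := near_xb _ (maxn N N1) c2; rewrite geq_max => /andP[Nk N1k] xk.
have trapped j : (k <= j)%N -> enorm (x j - xb) <= c.
  elim/ltn_ind: j => j IH kj.
  have hg i : (k <= i < j)%N -> c <= enorm (g i).
    move=> /andP[ki ij]; apply: ltW; apply: big; first exact: leq_trans ki.
    exact: IH.
  have h1 := run_travel_between c0 kj hg.
  have : f (x k) - f (x j) < c / 2 / (2 / (beta * c)) by exact: hN1.
  rewrite ltr_pdivlMr // => h2.
  have := enormD (x j - x k) (x k - xb); rewrite addrA subrK; lra.
have [N2 hN2] := run_nu_small c0.
pose J := maxn k N2.
have stuck i : reductions (J + i) = reductions J.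
  elim: i => [|i IH]; first by rewrite addn0.
  have kJ : (k <= J + i)%N by rewrite (leq_trans (leq_maxl k N2)) // leq_addr.
  have NJ : (N2 <= J + i)%N by rewrite (leq_trans (leq_maxr k N2)) // leq_addr.
  rewrite addnS reductionsS IH leNgt (lt_trans (hN2 _ NJ)) ?addn0 //.
  by apply: big; [exact: leq_trans kJ|exact: trapped].
have [k' hk'] := reductions_unbounded (reductions J).+1.
have := reductions_mono (leq_addl J k'); rewrite stuck.
by move=> /(leq_trans hk'); rewrite ltnn.
Qed.

Lemma run_cluster_stationary xb :
  cluster (x @ \oo) xb -> clarke_stationary f xb.
Proof.
move=> xb_cl; apply: clarke_closed => // e e0.
have e2 : 0 < e / 2 by rewrite divr_gt0.
have M1 : 0 < `|M| + 1 by rewrite ltr_wpDl.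
have [N hN] := run_eps_small (divr_gt0 e2 M1).
have near_xb e' N' : 0 < e' -> exists2 k, (N' <= k)%N & enorm (x k - xb) < e'.
  move=> e'0.
  have h1 : (x @ \oo) [set y | exists2 k, (N' <= k)%N & x k = y].
    by exists N' => // k /= Nk; exists k.
  have h2 : nbhs xb [set y | enorm (y - xb) < e'] by apply/nbhs_enorm; exists e'.
  by have [_ [[k Nk <-] hk]] := xb_cl _ _ h1 h2; exists k.
have [k [Nk xk gk]] := run_small_gradient_near N e2 near_xb.
exists (g k); first by apply: (le_trans gk); lra.
have [dx dU] := run_well_defined k.
have [gconv _] := step2 (run_well_defined k).
apply: conv_mono gconv => v [->|[i ->]].
  by exists (x k); split => //; apply: (le_trans xk); lra.
exists (x k + eps k *: U k i); split => //.
rewrite addrAC (le_trans (enormD _ _)) // enormZ gtr0_norm //.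
have h1 : eps k < e / 2 / (`|M| + 1) by exact: hN.
have h2 : enorm (U k i) <= `|M| + 1.
  by apply: (le_trans (U_bounded k i)); rewrite (le_trans (ler_norm M)) // lerDl.
have h3 : eps k * enorm (U k i) <= eps k * (`|M| + 1) by rewrite ler_pM2l.
move: h1; rewrite ltr_pdivlMr // => h1; lra.
Qed.

Lemma run_targets_vanish :
  [/\ forall k, nu k.+1 <= nu k, nu @ \oo --> 0,
      forall k, eps k.+1 <= eps k & eps @ \oo --> 0].
Proof.
have mono (th c : R) k : 0 < th < 1 -> 0 < c ->
    th ^+ reductions k.+1 * c <= th ^+ reductions k * c.
  move=> /andP[th0 th1] c0; rewrite ler_pM2r //.
  by rewrite ler_wiXn2l ?(ltW th0) ?(ltW th1) // reductions_mono.
split.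
- move=> k; have [_ _ ->] := run_invariant k.
  by have [_ _ ->] := run_invariant k.+1; exact: mono.
- apply/cvgrPdist_lt => e e0; have [N hN] := run_nu_small e0.
  by exists N => // k /= Nk; rewrite sub0r normrN gtr0_norm // hN.
- move=> k; have [_ -> _] := run_invariant k.
  by have [_ -> _] := run_invariant k.+1; exact: mono.
- apply/cvgrPdist_lt => e e0; have [N hN] := run_eps_small e0.
  by exists N => // k /= Nk; rewrite sub0r normrN gtr0_norm // hN.
Qed.

End Run.

Theorem theorem3p1 (R : realType) (n m : nat)
  (f : 'rV[R]_n -> R) (D : set 'rV[R]_n)
  (x0 : 'rV[R]_n) (eps0 nu0 beta gamma theta_nu theta_eps : R)
  (d : measure_display) (Omega : measurableType d) (P : probability Omega R)
  (x : nat -> Omega -> 'rV[R]_n) (U : nat -> 'I_m -> Omega -> 'rV[R]_n)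
  (g : nat -> Omega -> 'rV[R]_n) (eps nu t : nat -> Omega -> R)
  (* assumptions on f *)
  (f_lip : locally_lipschitz f)
  (D_open : open D)
  (f_C1 : C1_on f D)
  (D_full : leb_null (~` D))
  (* inputs of Algorithm GS *)
  (x0_diff : differentiable f x0)
  (eps0_gt0 : 0 < eps0) (nu0_gt0 : 0 < nu0)
  (m_ge : (n.+1 <= m)%N)
  (beta01 : 0 < beta < 1) (gamma01 : 0 < gamma < 1)
  (theta_nu01 : 0 < theta_nu < 1) (theta_eps01 : 0 < theta_eps < 1)
  (* Step 1: x^{k,i} = x^k + eps_k U^{k,i}, where U^{k,1..m} are uniform on the
     closed unit ball, mutually independent, and independent of everything
     generated before iteration k *)
  (U_meas : forall k i a b, measurable (U k i @^-1` obox a b))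
  (U_unif : forall k i a b,
     (P (U k i @^-1` obox a b) * leb_outer (eball (0 : 'rV[R]_n) 1)
      = leb_outer (obox a b `&` eball 0 1))%E)
  (hist_meas : forall k A, history_gen x U g eps nu t k A -> measurable A)
  (U_indep : forall k A (a b : 'I_m -> 'rV[R]_n),
     <<s history_gen x U g eps nu t k >> A ->
     (P (A `&` [set w | forall i, obox (a i) (b i) (U k i w)])
      = P A * \prod_(i < m) P (U k i @^-1` obox (a i) (b i)))%E)
  (* initialisation *)
  (init : forall w, x 0 w = x0 /\ eps 0 w = eps0 /\ nu 0 w = nu0)
  (* Step 2 *)
  (step2 : forall k w, gs_well_defined f x U eps k w ->
     min_norm_elt (sample_grads f (x k w) (eps k w) (U k ^~ w)) (g k w))
  (* Step 4 (when not terminated at Step 3) *)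
  (step4 : forall k w, gs_well_defined f x U eps k w ->
     ~ gs_terminates (g k w) (eps k w) ->
     (enorm (g k w) <= nu k w ->
        nu k.+1 w = theta_nu * nu k w /\ eps k.+1 w = theta_eps * eps k w /\
        t k w = 0) /\
     (nu k w < enorm (g k w) ->
        nu k.+1 w = nu k w /\ eps k.+1 w = eps k w /\
        armijo_steps f beta gamma (x k w) (g k w) (t k w) /\
        (forall s, armijo_steps f beta gamma (x k w) (g k w) s -> s <= t k w)))
  (* Step 5 (when not terminated at Step 3) *)
  (step5 : forall k w, gs_well_defined f x U eps k w ->
     ~ gs_terminates (g k w) (eps k w) ->
     (differentiable f (x k w - t k w *: g k w) ->
        x k.+1 w = x k w - t k w *: g k w) /\
     (~ differentiable f (x k w - t k w *: g k w) ->
        differentiable f (x k.+1 w) /\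
        f (x k.+1 w) < f (x k w) - beta * t k w * enorm (g k w) ^+ 2 /\
        enorm (x k w - t k w *: g k w - x k.+1 w)
          <= Num.min (t k w) (eps k w) * enorm (g k w))) :
  {ae P, forall w,
    (forall k, gs_well_defined f x U eps k w) /\
    (forall k, ~ gs_terminates (g k w) (eps k w)) /\
    (((forall k, f (x k.+1 w) <= f (x k w)) /\
      (fun k => f (x k w)) @ \oo --> -oo)
     \/
     ((forall k, nu k.+1 w <= nu k w) /\ (fun k => nu k w) @ \oo --> 0 /\
      (forall k, eps k.+1 w <= eps k w) /\ (fun k => eps k w) @ \oo --> 0 /\
      (forall xb, cluster ((fun k => x k w) @ \oo) xb ->
         clarke_stationary f xb)))}.
Proof.
have n_gt0 := leb_outer_nat_gt0 D_full.
have m_gt0 : (0 < m)%N by exact: leq_trans m_ge.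
(* The sample [U 0 i0] doubles as the mollifying vector, so the given probability space suffices for
   the mean value inequality. *)
pose i0 := Ordinal m_gt0.
pose G k := history_gen x U g eps nu t k.
have G_X k a b : G k (x k @^-1` obox a b).
  by exists k; left; split => //; exists a, b.
have G_U j k i a b : (j < k)%N -> G k (U j i @^-1` obox a b).
  by move=> jk; exists j; do 3 right; left; split => //; exists i, a, b.
have W_null (z : 'rV[R]_n) (e : R) : 0 < e ->
    P.-negligible [set w | ~ D (z + e *: U 0 i0 w)].
  by move=> e0; exact: (fixed_center_negligible n_gt0 U_meas U_unif 0 i0 z D_full e0).
have mean_value := mean_value_ball (U_meas 0 i0)
  (unit_uniform_bounded n_gt0 (U_meas 0 i0) (U_unif 0 i0)) f_lip D_open f_C1.1 W_null.
have [te0 _] := andP theta_eps01.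
(* Every potential radius [theta_eps ^+ q.2 * eps0] is covered, which spares the analysis of the
   random index that is actually in force. *)
pose E1 (q : nat * 'I_m * nat) w :=
  D (x q.1.1 w + (theta_eps ^+ q.2 * eps0) *: U q.1.1 q.1.2 w).
pose E2 (q : nat * 'I_m) w := obox (const_mx (-2)) (const_mx 2) (U q.1 q.2 w).
(* Finite functions into integer vectors make the index type countable; the premise keeps only
   tuples of boxes that meet the open unit ball and so have positive probability. *)
pose E3 (q : nat * {ffun 'I_m -> 'rV[int]_n} * nat) w :=
  (exists u : 'I_m -> 'rV[R]_n, (forall i, grid_box q.1.1 (q.1.2 i) (u i)) /\
     forall i, enorm (u i) < 1) ->
  exists2 k, (q.2 <= k)%N & forall i, grid_box q.1.1 (q.1.2 i) (U k i w).
have N1 : P.-negligible [set w | ~ forall q, E1 q w].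
  apply: ae_forall_countable => -[[k i] j].
  apply: (sample_negligible n_gt0 U_meas U_unif hist_meas G_X U_indep _ _ D_full).
  by rewrite mulr_gt0 ?exprn_gt0.
have N2 : P.-negligible [set w | ~ forall q, E2 q w].
  by apply: ae_forall_countable => -[k i]; exact: bounded_negligible.
have N3 : P.-negligible [set w | ~ forall q, E3 q w].
  apply: ae_forall_countable => -[[l z] k0].
  have [[u [uz u1]]|none] := pselect (exists u : 'I_m -> 'rV[R]_n,
      (forall i, grid_box l (z i) (u i)) /\ forall i, enorm (u i) < 1); last first.
    apply: (@negligibleS _ _ _ _ set0); last exact: negligible_set0.
    by move=> w; apply => /none.
  apply: negligibleS (boxes_hit_io n_gt0 U_meas U_unif hist_meas G_U U_indep k0 uz u1).
  move=> w nE k kk0 hit; apply: nE => _; by exists k.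
apply: (negligibleS _ (negligibleU N1 (negligibleU N2 N3))) => w nw.
apply: contrapT => notin; apply: nw.
have e1 q : E1 q w by move: q; apply: contrapT => h; apply: notin; left.
have e2 q : E2 q w by move: q; apply: contrapT => h; apply: notin; right; left.
have e3 q : E3 q w by move: q; apply: contrapT => h; apply: notin; right; right.
have [x_init [eps_init nu_init]] := init w.
have x0d : differentiable f (x 0 w) by rewrite x_init.
have inD k i j : D (x k w + (theta_eps ^+ j * eps0) *: U k i w) by exact: (e1 (k, i, j)).
have Ub k i : enorm (U k i w) <= n.+1%:R * 2.
  apply: enorm_le_sup => // j; have := e2 (k, i) j; rewrite !mxE ler_norml => /andP[h1 h2].
  by rewrite !ltW.
have hit (u : 'I_m -> 'rV[R]_n) (a : R) k0 : 0 < a -> (forall i, enorm (u i) < 1) ->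
    exists2 k, (k0 <= k)%N & forall i, enorm (U k i w - u i) < a.
  move=> a0 u1; have [l hl] := grid_box_fine (n := n) a0.
  have cell i : exists z, grid_box l z (u i) /\
      forall y', grid_box l z y' -> enorm (y' - u i) < a.
    by have [z z1 z2] := hl (u i); exists z.
  have [z hz] := choice cell.
  have [|k kk0 hk] := e3 (l, [ffun i => z i], k0).
    by exists u; split => // i; rewrite /= ffunE; have [] := hz i.
  by exists k => // i; have [_ h] := hz i; apply: h; have := hk i; rewrite ffunE.
have s2 k := step2 k w; have s4 k := step4 k w; have s5 k := step5 k w.
have wd := run_well_defined f_C1 eps0_gt0 theta_eps01 x0d eps_init nu_init s4 s5 inD.
have cont := run_continues f_C1 eps0_gt0 theta_eps01 x0d eps_init nu_init s4 s5 inD.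
split; first exact: wd.
split; first exact: cont.
have decr := run_nonincreasing f_C1 eps0_gt0 beta01 gamma01 theta_eps01 x0d eps_init nu_init
  s4 s5 inD.
have [bnd|unbnd] := pselect (exists lb, forall k, lb <= f (x k w)); last first.
  left; split => //; apply/cvgrNyPle => A.
  have [N hN] : exists N, f (x N w) <= A.
    apply: contrapT => none; apply: unbnd; exists A => k.
    by rewrite leNgt; apply/negP => h; apply: none; exists k; exact: ltW.
  exists N => // k /= /subnKC <-; elim: (k - N)%N => [|i IH]; first by rewrite addn0.
  by rewrite addnS (le_trans (decr _)).
right.
have [nu_mono nu_lim eps_mono eps_lim] := run_targets_vanish f_lip D_open f_C1 mean_value
  eps0_gt0 nu0_gt0 m_ge beta01 gamma01 theta_nu01 theta_eps01 x0d eps_init nu_init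
  s2 s4 s5 inD hit bnd.
do 4 split => //.
move=> xb; exact: (run_cluster_stationary f_lip D_open f_C1 mean_value
  eps0_gt0 nu0_gt0 m_ge beta01 gamma01 theta_nu01 theta_eps01 x0d eps_init nu_init
  s2 s4 s5 inD Ub hit bnd).
Qed.
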